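(* Assume that $k,\rho,c$ and $\mu$ (with $v(T)=\mu(T)/\sqrt t$) satisfy the boundedness and Lipschitz hypotheses (K), (R), (V) listed in the context, and that $$\frac{2k_M\widetilde k\,(T^*-T_m)}{k_m^2}<1 .$$ Let $\lambda_2>\lambda_1$ be a solution of $\mathcal V_2(\lambda)=\lambda$, and assume $\mathcal E(\lambda_2)<1$. Then there exists at least one solution $(T,s)$ of the Stefan problem $$\rho(T)c(T)\frac{\partial T}{\partial t}=\frac{\partial}{\partial x}\Big(k(T)\frac{\partial T}{\partial x}\Big)-v(T)\frac{\partial T}{\partial x},\quad 0<x<s(t),\ t>0,$$ $$T(0,t)=T^*,\qquad T(s(t),t)=T_m,\qquad k(T(s(t),t))\frac{\partial T}{\partial x}(s(t),t)=-\rho_0\ell\,\dot s(t),\quad t>0,\qquad s(0)=0,$$ where the free boundary is $s(t)=2\widetilde\lambda\sqrt{\alpha_0t}$, $t>0$, with $\widetilde\lambda\in(\lambda_1,\lambda_2)$ a solution of $\mathcal V(\lambda)=\lambda$, and the temperature is $$T(x,t)=(T_m-T^* )f_{\widetilde\lambda}(\xi)+T^*,\qquad \xi=\frac{x}{2\sqrt{\alpha_0t}},\quad 0\le\xi\le\widetilde\lambda,$$ where $f_{\widetilde\lambda}\in C^0[0,\widetilde\lambda]$ is the unique solution of $f(\xi)=\Phi(f)(\xi)/\Phi(f)(\widetilde\lambda)$, $0\le \xi\le\widetilde\lambda$.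
   Context: Data: real constants $T^*>T_m$; positive constants $\rho_0,c_0,k_0,\ell$; $\alpha_0=k_0/(\rho_0c_0)$; $\mathrm{Ste}=(T^*-T_m)c_0/\ell>0$. The coefficients $k,\rho,c,\mu$ are real functions of temperature acting by composition, e.g. $k(T)(x,t)=k(T(x,t))$, and the convective speed is $v(T)=\mu(T)/\sqrt t$. Let $\mathscr C=C^0(\mathbb R_0^+\times\mathbb R^+)\cap L^\infty(\mathbb R_0^+\times\mathbb R^+)$ with the supremum norm $\|\cdot\|$. Hypotheses: there are positive constants $k_m,k_M,\widetilde k,\gamma_m,\gamma_M,\widetilde\gamma,\nu_m,\nu_M,\widetilde\nu$ such that for all $T,T_1,T_2\in\mathscr C$: (K) $k_m\le k(T)\le k_M$ and $\|k(T_1)-k(T_2)\|\le\widetilde k\|T_1-T_2\|$; (R) $\gamma_m\le\rho(T)c(T)\le\gamma_M$ and $\|\rho(T_1)c(T_1)-\rho(T_2)c(T_2)\|\le\widetilde\gamma\|T_1-T_2\|$; (V) $\nu_m\le\mu(T)\le\nu_M$ and $\|\mu(T_1)-\mu(T_2)\|\le\widetilde\nu\|T_1-T_2\|$. For a function $f$ of $\xi$ put $T=(T_m-T^* )f+T^*$ and $L^*(f)=k(T)/k_0$, $N^*(f)=\rho(T)c(T)/(\rho_0c_0)$, $\mu^*(f)=\mu(T)/\sqrt{\rho_0c_0k_0}$ (pointwise in $\xi$). Constants: $L_m=k_m/k_0$, $L_M=k_M/k_0$, $\widetilde L=\widetilde k(T^*-T_m)/k_0$, $N_m=\gamma_m/(\rho_0c_0)$,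 $N_M=\gamma_M/(\rho_0c_0)$, $\widetilde N=\widetilde\gamma(T^*-T_m)/(\rho_0c_0)$, $\mu_m=\nu_m/\sqrt{\rho_0c_0k_0}$, $\mu_M=\nu_M/\sqrt{\rho_0c_0k_0}$, $\widetilde\mu=\widetilde\nu(T^*-T_m)/\sqrt{\rho_0c_0k_0}$. For $f\in C^0[0,\lambda]$: $U(f)(z)=\exp\big(2\int_0^z\frac{\mu^*(f)(\sigma)}{L^*(f)(\sigma)}d\sigma\big)$, $I(f)(z)=\exp\big(2\int_0^z\frac{\sigma N^*(f)(\sigma)}{L^*(f)(\sigma)}d\sigma\big)$, $E(f)=U(f)/I(f)$, $\Phi(f)(\xi)=\int_0^\xi\frac{E(f)(z)}{L^*(f)(z)}dz$. Define, for $z\geq 0$, $D_1(z)=\frac{2\exp(2\mu_Mz/L_m)}{L_m^2}z(\mu_M\widetilde L+L_m\widetilde\mu)$, $D_2(z)=\frac{\exp(N_Mz^2/L_m)}{L_m^2}z^2(N_M\widetilde L+L_m\widetilde N)$, $D_3(z)=\exp(\frac{N_M}{L_m}z^2)D_1(z)+\exp(2\frac{\mu_M}{L_m}z)D_2(z)$, $D_4(z)=\frac1{L_m^2}\big(\widetilde L\exp(2z\frac{\mu_M}{L_m})+L_mD_3(z)\big)$, and $\mathcal E(z)=2D_4(z)L_M\exp(\frac{N_M}{L_m}z^2)$. Under the stated smallness condition there is a unique $\overline\lambda>0$ with $\mathcal E(\overline\lambda)=1$, and for each $0<\lambda<\overline\lambda$ there is a unique $f_\lambda\in C^0[0,\lambda]$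 with $f_\lambda(\xi)=\Phi(f_\lambda)(\xi)/\Phi(f_\lambda)(\lambda)$ on $[0,\lambda]$. Set $\mathcal V(\lambda)=\frac{\mathrm{Ste}}2\frac{E(f_\lambda)(\lambda)}{\Phi(f_\lambda)(\lambda)}$ for $0<\lambda<\overline\lambda$. For $\lambda>0$: $\mathcal V_1(\lambda)=\mathrm{Ste}\,\mu_M\exp(-2\lambda\frac{\mu_M}{L_m}-2\lambda^2\frac{N_M}{L_m})$ and $\mathcal V_2(\lambda)=\frac{\mathrm{Ste}}{\sqrt\pi}\frac{\sqrt{N_M}}{\sqrt{L_m}}L_M\frac{\exp(2\lambda\mu_M/L_m-\lambda^2N_m/L_M)}{\operatorname{erf}(\sqrt{N_M/L_m}\,\lambda)}$. $\lambda_1$ is the unique positive solution of $\mathcal V_1(\lambda)=\lambda$; the equation $\mathcal V_2(\lambda)=\lambda$ has at least one solution larger than $\lambda_1$. *)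

(* Defs.v *)
From Stdlib Require Import Reals ClassicalEpsilon.
From Coquelicot Require Import Coquelicot.
Open Scope R_scope.

Record stefan_data := StefanData {
  Tstar : R; Tmelt : R;
  rho0 : R; c0 : R; k0 : R; ell : R;
  coef_k : R -> R; coef_rho : R -> R; coef_c : R -> R; coef_mu : R -> R
}.

(* [k_lip], [gamma_lip], [nu_lip] are the Lipschitz constants written with a
   tilde; the gamma's concern the product rho * c. *)
Record coef_bounds := CoefBounds {
  k_m : R; k_M : R; k_lip : R;
  gamma_m : R; gamma_M : R; gamma_lip : R;
  nu_m : R; nu_M : R; nu_lip : R
}.

Definition alpha0 (d : stefan_data) : R := k0 d / (rho0 d * c0 d).
Definition Ste (d : stefan_data) : R := (Tstar d - Tmelt d) * c0 d / ell d.

Definition coef_rhoc (d : stefan_data) (tau : R) : R :=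
  coef_rho d tau * coef_c d tau.

Definition data_admissible (d : stefan_data) : Prop :=
  Tmelt d < Tstar d /\ 0 < rho0 d /\ 0 < c0 d /\ 0 < k0 d /\ 0 < ell d.

Definition bounds_positive (b : coef_bounds) : Prop :=
  (0 < k_m b /\ 0 < k_M b /\ 0 < k_lip b) /\
  (0 < gamma_m b /\ 0 < gamma_M b /\ 0 < gamma_lip b) /\
  (0 < nu_m b /\ 0 < nu_M b /\ 0 < nu_lip b).

(* Temperatures are total functions of (x, t); only their values on the
   quarter-plane 0 <= x, 0 < t are used here. *)
Definition quarter_plane (p : R * R) : Prop := 0 <= fst p /\ 0 < snd p.

Definition in_C (T : R -> R -> R) : Prop :=
  continuous_on quarter_plane (fun p : R * R => T (fst p) (snd p)) /\
  exists M : R, forall x t : R, quarter_plane (x, t) -> Rabs (T x t) <= M.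

Definition sup_norm (g : R -> R -> R) : Rbar :=
  Lub_Rbar (fun r => exists x t : R, quarter_plane (x, t) /\ r = Rabs (g x t)).

Definition coef_hyp (h : R -> R) (hm hM hlip : R) : Prop :=
  (forall T : R -> R -> R, in_C T ->
     forall x t : R, quarter_plane (x, t) -> hm <= h (T x t) <= hM) /\
  (forall T1 T2 : R -> R -> R, in_C T1 -> in_C T2 ->
     Rbar_le (sup_norm (fun x t => h (T1 x t) - h (T2 x t)))
             (Rbar_mult hlip (sup_norm (fun x t => T1 x t - T2 x t)))).

Definition hyp_K (d : stefan_data) (b : coef_bounds) : Prop :=
  coef_hyp (coef_k d) (k_m b) (k_M b) (k_lip b).
Definition hyp_R (d : stefan_data) (b : coef_bounds) : Prop :=
  coef_hyp (coef_rhoc d) (gamma_m b) (gamma_M b) (gamma_lip b).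
Definition hyp_V (d : stefan_data) (b : coef_bounds) : Prop :=
  coef_hyp (coef_mu d) (nu_m b) (nu_M b) (nu_lip b).

Definition temp (d : stefan_data) (f : R -> R) (xi : R) : R :=
  (Tmelt d - Tstar d) * f xi + Tstar d.

Definition Lstar (d : stefan_data) (f : R -> R) (xi : R) : R :=
  coef_k d (temp d f xi) / k0 d.
Definition Nstar (d : stefan_data) (f : R -> R) (xi : R) : R :=
  coef_rhoc d (temp d f xi) / (rho0 d * c0 d).
Definition mustar (d : stefan_data) (f : R -> R) (xi : R) : R :=
  coef_mu d (temp d f xi) / sqrt (rho0 d * c0 d * k0 d).

Definition L_m (d : stefan_data) (b : coef_bounds) : R := k_m b / k0 d.
Definition L_M (d : stefan_data) (b : coef_bounds) : R := k_M b / k0 d.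
Definition L_lip (d : stefan_data) (b : coef_bounds) : R :=
  k_lip b * (Tstar d - Tmelt d) / k0 d.
Definition N_m (d : stefan_data) (b : coef_bounds) : R :=
  gamma_m b / (rho0 d * c0 d).
Definition N_M (d : stefan_data) (b : coef_bounds) : R :=
  gamma_M b / (rho0 d * c0 d).
Definition N_lip (d : stefan_data) (b : coef_bounds) : R :=
  gamma_lip b * (Tstar d - Tmelt d) / (rho0 d * c0 d).
Definition mu_M (d : stefan_data) (b : coef_bounds) : R :=
  nu_M b / sqrt (rho0 d * c0 d * k0 d).
Definition mu_lip (d : stefan_data) (b : coef_bounds) : R :=
  nu_lip b * (Tstar d - Tmelt d) / sqrt (rho0 d * c0 d * k0 d).

Definition Ufun (d : stefan_data) (f : R -> R) (z : R) : R :=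
  exp (2 * RInt (fun sigma => mustar d f sigma / Lstar d f sigma) 0 z).
Definition Ifun (d : stefan_data) (f : R -> R) (z : R) : R :=
  exp (2 * RInt (fun sigma => sigma * Nstar d f sigma / Lstar d f sigma) 0 z).
Definition Efun (d : stefan_data) (f : R -> R) (z : R) : R := Ufun d f z / Ifun d f z.
Definition Phi (d : stefan_data) (f : R -> R) (xi : R) : R :=
  RInt (fun z => Efun d f z / Lstar d f z) 0 xi.

Definition D1 (d : stefan_data) (b : coef_bounds) (z : R) : R :=
  2 * exp (2 * mu_M d b * z / L_m d b) / (L_m d b) ^ 2 * z *
  (mu_M d b * L_lip d b + L_m d b * mu_lip d b).
Definition D2 (d : stefan_data) (b : coef_bounds) (z : R) : R :=
  exp (N_M d b * z ^ 2 / L_m d b) / (L_m d b) ^ 2 * z ^ 2 *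
  (N_M d b * L_lip d b + L_m d b * N_lip d b).
Definition D3 (d : stefan_data) (b : coef_bounds) (z : R) : R :=
  exp (N_M d b / L_m d b * z ^ 2) * D1 d b z +
  exp (2 * (mu_M d b / L_m d b) * z) * D2 d b z.
Definition D4 (d : stefan_data) (b : coef_bounds) (z : R) : R :=
  1 / (L_m d b) ^ 2 *
  (L_lip d b * exp (2 * z * (mu_M d b / L_m d b)) + L_m d b * D3 d b z).
Definition Ecal (d : stefan_data) (b : coef_bounds) (z : R) : R :=
  2 * D4 d b z * L_M d b * exp (N_M d b / L_m d b * z ^ 2).

(* Elements of C^0[0, lam] are represented by total functions, so equality in
   C^0[0, lam] is pointwise equality on [0, lam]. *)
Definition C0 (lam : R) (f : R -> R) : Prop :=
  continuous_on (fun xi => 0 <= xi <= lam) f.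

Definition is_profile (d : stefan_data) (lam : R) (f : R -> R) : Prop :=
  C0 lam f /\
  forall xi : R, 0 <= xi <= lam -> f xi = Phi d f xi / Phi d f lam.

Definition is_unique_profile (d : stefan_data) (lam : R) (f : R -> R) : Prop :=
  is_profile d lam f /\
  forall g : R -> R, is_profile d lam g ->
    forall xi : R, 0 <= xi <= lam -> g xi = f xi.

(* f_lam: some fixed point on [0, lam], an arbitrary function if there is none.
   It is meaningful where [is_unique_profile d lam (profile d lam)] holds. *)
Definition profile (d : stefan_data) (lam : R) : R -> R :=
  epsilon (inhabits (fun _ : R => 0)) (is_profile d lam).

Definition Vcal (d : stefan_data) (lam : R) : R :=
  Ste d / 2 * (Efun d (profile d lam) lam / Phi d (profile d lam) lam).

Definition erf (z : R) : R :=
  2 / sqrt PI * RInt (fun u => exp (- u ^ 2)) 0 z.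

Definition V1 (d : stefan_data) (b : coef_bounds) (lam : R) : R :=
  Ste d * mu_M d b *
  exp (- 2 * lam * (mu_M d b / L_m d b) - 2 * lam ^ 2 * (N_M d b / L_m d b)).
Definition V2 (d : stefan_data) (b : coef_bounds) (lam : R) : R :=
  Ste d / sqrt PI * (sqrt (N_M d b) / sqrt (L_m d b)) * L_M d b *
  (exp (2 * lam * mu_M d b / L_m d b - lam ^ 2 * N_m d b / L_M d b) /
   erf (sqrt (N_M d b / L_m d b) * lam)).

Definition is_left_derive (g : R -> R) (a l : R) : Prop :=
  filterlim (fun y => (g y - g a) / (y - a)) (at_left a) (locally l).

Definition velocity (d : stefan_data) (tau t : R) : R := coef_mu d tau / sqrt t.

Definition heat_equation (d : stefan_data) (T : R -> R -> R) (x t : R) : Prop :=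
  let T_x := fun y => Derive (fun z => T z t) y in
  let flux := fun y => coef_k d (T y t) * T_x y in
  ex_derive (fun tau => T x tau) t /\
  ex_derive (fun y => T y t) x /\
  ex_derive flux x /\
  coef_rho d (T x t) * coef_c d (T x t) * Derive (fun tau => T x tau) t =
  Derive flux x - velocity d (T x t) t * T_x x.

(* Classical solution.  T matters only on 0 <= x <= s(t), t > 0, so its
   x-derivative at the free boundary is the one-sided one; since s is
   continuous, the two-sided derivatives in 0 < x < s(t) do not see values of T
   outside that domain. *)
Definition is_stefan_solution
    (d : stefan_data) (T : R -> R -> R) (s : R -> R) : Prop :=
  continuous_on (fun t => 0 <= t) s /\
  (forall t : R, 0 < t -> 0 < s t /\ ex_derive s t) /\
  continuous_on (fun p : R * R => 0 < snd p /\ 0 <= fst p <= s (snd p))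
                (fun p : R * R => T (fst p) (snd p)) /\
  (forall x t : R, 0 < t -> 0 < x < s t -> heat_equation d T x t) /\
  (forall t : R, 0 < t -> T 0 t = Tstar d) /\
  (forall t : R, 0 < t -> T (s t) t = Tmelt d) /\
  (forall t : R, 0 < t ->
     exists q : R, is_left_derive (fun x => T x t) (s t) q /\
       coef_k d (T (s t) t) * q = - rho0 d * ell d * Derive s t) /\
  s 0 = 0.

(* Main.v *)
(* A profile is a fixed point of f |-> Phi(f) / Phi(f)(lam), which for lam <= lam2 contracts the sup
   norm by the factor Ecal(lam2) < 1.  Extended by the constant 1 beyond lam, the profile for lam is
   a fixed point of the operator for any lam' > lam up to an error O(lam' - lam), so profiles, and
   hence Vcal, are Lipschitz in lam.  Elementary bounds on E and Phi give V1 < Vcal < V2, so Vcal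
   crosses the diagonal between lam1 and lam2, and at the crossing the similarity ansatz turns the
   fixed-point equation into the heat equation and Vcal(lam) = lam into the Stefan condition. *)
Require Import Defs.
From Stdlib Require Import Reals Lra Lia ClassicalEpsilon.
From Coquelicot Require Import Coquelicot.
Open Scope R_scope.

(** * Analysis on the real line *)

(** The [D]'s are Lipschitz constants with respect to the profile: [D1] for [U], [D2] for [I], [D3]
    for [E], [D4] for the integrand of [Phi]. In the ratio [Phi f z / Phi f lam] the numerator and
    the denominator each move by at most [lam * D4] times the distance, whence the 2 in [Ecal]; the
    denominator is at least [lam] times a positive constant, so [lam] cancels and the factor does
    not blow up on short intervals. The profiles live on different intervals. All constants are
    therefore frozen at one right end [Z] (finally [lam2]) instead of being taken at [lam]: a single
    factor serves every [lam <= Z], and one estimate on [[0, w]] with [w <= Z] yields existence,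
    uniqueness and dependence on [lam]. The Lipschitz constant of [Vcal] degenerates as [lam] tends
    to 0, so it is only claimed away from 0, here on [[lam1, lam2]]. The coefficient [k] is merely
    Lipschitz, so [k(T)] cannot be differentiated by itself. The flux can: in [k(T) T_x] the
    coefficient cancels against the [1 / Lstar] in the derivative of [Phi], which leaves a constant
    multiple of [E]. *)

Lemma exp_le (x y : R) : x <= y -> exp x <= exp y.
Proof. intros [H | ->]; [left; now apply exp_increasing | lra]. Qed.

Lemma exp_le_inv (x y : R) : exp x <= exp y -> x <= y.
Proof.
  intros H. apply Rnot_lt_le. intros Hyx. apply exp_increasing in Hyx. lra.
Qed.

(** The tangent inequality [1 + (a - c) <= exp (a - c)], multiplied by [exp c], bounds the increment
    from [a] to [c]. *)
Lemma abs_exp_diff_le (M x y : R) :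
  x <= M -> y <= M -> Rabs (exp x - exp y) <= exp M * Rabs (x - y).
Proof.
  intros Hx Hy.
  assert (one_sided : forall a c, a <= c -> c <= M -> exp c - exp a <= exp M * (c - a)).
  { intros a c Hac HcM.
    assert (H1 := exp_ineq1_le (a - c)).
    assert (H2 : exp a = exp c * exp (a - c)) by (rewrite <- exp_plus; f_equal; ring).
    assert (H3 := exp_le c M HcM).
    assert (H4 := exp_pos c). nra. }
  destruct (Rle_dec x y) as [H | H].
  - assert (H1 := one_sided x y H Hy). assert (H2 := exp_le x y H).
    rewrite !Rabs_left1 by lra. nra.
  - assert (H1 := one_sided y x ltac:(lra) Hx). assert (H2 := exp_le y x ltac:(lra)).
    rewrite !Rabs_right by lra. lra.
Qed.

Lemma continuous_of_dominated (f g : R -> R) (K x : R) :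
  (forall y, Rabs (g y - g x) <= K * Rabs (f y - f x)) ->
  continuous f x -> continuous g x.
Proof.
  intros Hdom Hf.
  apply filterlim_locally. intros eps.
  (* The [+ 1] keeps the divisor positive even when [K] is zero. *)
  assert (HK : 0 < Rabs K + 1) by (assert (H := Rabs_pos K); lra).
  assert (He : 0 < eps / (Rabs K + 1)) by (apply Rdiv_lt_0_compat; [apply cond_pos | lra]).
  assert (H := proj1 (filterlim_locally f (f x)) Hf (mkposreal _ He)).
  revert H. apply filter_imp. intros y Hy.
  change (Rabs (f y - f x) < eps / (Rabs K + 1)) in Hy.
  change (Rabs (g y - g x) < eps).
  apply Rle_lt_trans with (1 := Hdom y).
  assert (H1 := Rle_abs K). assert (H2 := Rabs_pos (f y - f x)).
  apply Rle_lt_trans with ((Rabs K + 1) * Rabs (f y - f x)); [nra |].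
  replace (pos eps) with ((Rabs K + 1) * (eps / (Rabs K + 1))) by (field; lra).
  apply Rmult_lt_compat_l; lra.
Qed.

Lemma lipschitz_continuous (g : R -> R) (K : R) :
  (forall x y, Rabs (g y - g x) <= K * Rabs (y - x)) -> forall x, continuous g x.
Proof.
  intros H x. apply continuous_of_dominated with (f := fun y => y) (K := K).
  - intros y. apply H.
  - apply continuous_id.
Qed.

Lemma ex_RInt_continuous_global (f : R -> R) (a c : R) :
  (forall x, continuous f x) -> ex_RInt f a c.
Proof. intros Hf. apply (ex_RInt_continuous (V := R_CompleteNormedModule)). intros; apply Hf. Qed.

Lemma is_derive_primitive (f : R -> R) (x : R) :
  (forall x, continuous f x) -> is_derive (fun z => RInt f 0 z) x (f x).
Proof.
  intros Hf. apply is_derive_RInt with 0; [| apply Hf].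
  apply filter_forall. intros z. apply (RInt_correct (V := R_CompleteNormedModule)).
  now apply ex_RInt_continuous_global.
Qed.

(** Reduces integral bounds to a pointwise comparison with the derivative of an explicit [G]; below,
    [G] is linear, quadratic or exponential. *)
Lemma RInt_le_antiderivative (f G dG : R -> R) (z : R) :
  0 <= z -> (forall x, continuous f x) -> (forall x, continuous dG x) ->
  (forall x, is_derive G x (dG x)) -> (forall x, 0 <= x <= z -> f x <= dG x) ->
  RInt f 0 z <= G z - G 0.
Proof.
  intros Hz Hf HdG HG Hle.
  assert (H : is_RInt dG 0 z (G z - G 0)).
  { apply (is_RInt_derive (V := R_CompleteNormedModule)); intros; auto. }
  rewrite <- (is_RInt_unique _ _ _ _ H).
  apply RInt_le; auto using ex_RInt_continuous_global.
  intros x Hx. apply Hle. lra.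
Qed.

Lemma RInt_ge_antiderivative (f G dG : R -> R) (z : R) :
  0 <= z -> (forall x, continuous f x) -> (forall x, continuous dG x) ->
  (forall x, is_derive G x (dG x)) -> (forall x, 0 <= x <= z -> dG x <= f x) ->
  G z - G 0 <= RInt f 0 z.
Proof.
  intros Hz Hf HdG HG Hle.
  assert (H : is_RInt dG 0 z (G z - G 0)).
  { apply (is_RInt_derive (V := R_CompleteNormedModule)); intros; auto. }
  rewrite <- (is_RInt_unique _ _ _ _ H).
  apply RInt_le; auto using ex_RInt_continuous_global.
  intros x Hx. apply Hle. lra.
Qed.

Lemma RInt_diff_le_antiderivative (f g G dG : R -> R) (z : R) :
  0 <= z -> (forall x, continuous f x) -> (forall x, continuous g x) ->
  (forall x, continuous dG x) -> (forall x, is_derive G x (dG x)) ->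
  (forall x, 0 <= x <= z -> Rabs (f x - g x) <= dG x) ->
  Rabs (RInt f 0 z - RInt g 0 z) <= G z - G 0.
Proof.
  intros Hz Hf Hg HdG HG Hle.
  assert (H : forall f g : R -> R, (forall x, continuous f x) -> (forall x, continuous g x) ->
    (forall x, 0 <= x <= z -> Rabs (f x - g x) <= dG x) ->
    RInt f 0 z - RInt g 0 z <= G z - G 0).
  { clear f g Hf Hg Hle. intros f g Hf Hg Hle.
    assert (E : RInt (fun x => minus (f x) (g x)) 0 z = RInt f 0 z - RInt g 0 z).
    { apply (RInt_minus (V := R_CompleteNormedModule)); now apply ex_RInt_continuous_global. }
    rewrite <- E. apply RInt_le_antiderivative with (dG := dG); auto.
    - intros x. now apply (continuous_minus (V := R_NormedModule)).
    - intros x Hx. apply Rle_trans with (2 := Hle x Hx). apply Rle_abs. }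
  apply Rabs_le. split.
  - enough (RInt g 0 z - RInt f 0 z <= G z - G 0) by lra. apply H; auto.
    intros x Hx. rewrite Rabs_minus_sym. auto.
  - now apply H.
Qed.

(** Stands for solving [S <= c + q * S] with [S] the supremum of [u]. Iterating the self-bound from
    the a priori bound 1 leaves the excess [q ^ n] over the fixed point [c / (1 - q)] of the affine
    map. *)
Lemma le_of_affine_self_bound (D : R -> Prop) (u : R -> R) (c q : R) :
  0 <= q < 1 -> 0 <= c -> (forall x, D x -> u x <= 1) ->
  (forall delta, 0 <= delta -> (forall x, D x -> u x <= delta) ->
     forall x, D x -> u x <= c + q * delta) ->
  forall x, D x -> u x <= c / (1 - q).
Proof.
  intros Hq Hc Hu Hstep x Hx.
  assert (Hcq : 0 <= c / (1 - q)) by (apply Rdiv_le_0_compat; lra).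
  assert (H : forall n x, D x -> u x <= c / (1 - q) + q ^ n).
  { induction n as [| n IH]; intros y Hy.
    - simpl. assert (H := Hu y Hy). lra.
    - assert (H := Hstep (c / (1 - q) + q ^ n)).
      replace (c / (1 - q) + q ^ S n) with (c + q * (c / (1 - q) + q ^ n)).
      + apply H; auto. assert (0 <= q ^ n) by (apply pow_le; lra). lra.
      + simpl. field. lra. }
  apply (is_lim_seq_le (fun _ => u x) (fun n => c / (1 - q) + q ^ n)
           (u x) (c / (1 - q))); auto.
  - apply is_lim_seq_const.
  - replace (Finite (c / (1 - q))) with (Finite (c / (1 - q) + 0)) by (f_equal; ring).
    apply is_lim_seq_plus'; [apply is_lim_seq_const |].
    apply is_lim_seq_geom. rewrite Rabs_right; lra.
Qed.

(** Picard iteration from the zero function. Contraction is phrased through uniform bounds [delta]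
    rather than a norm, so no space of bounded functions has to be set up; the last hypothesis
    bounds the first step by 1, hence step [n] by [q ^ n]. *)
Lemma contraction_fixed_point (F : (R -> R) -> R -> R) (q : R) :
  0 <= q < 1 ->
  (forall f, (forall x, continuous f x) -> forall x, continuous (F f) x) ->
  (forall f g delta, (forall x, continuous f x) -> (forall x, continuous g x) ->
     (forall x, Rabs (f x - g x) <= delta) ->
     forall x, Rabs (F f x - F g x) <= q * delta) ->
  (forall x, Rabs (F (fun _ => 0) x) <= 1) ->
  exists f, (forall x, continuous f x) /\ forall x, F f x = f x.
Proof.
  intros Hq Fcont Fcontr F0.
  pose (fn := fun n => Nat.iter n F (fun _ => 0)).
  assert (fn_cont : forall n x, continuous (fn n) x).
  { induction n as [| n IH]; [intros x; apply continuous_const |].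
    intros x. apply (Fcont (fn n)). apply IH. }
  assert (fn_step : forall n x, Rabs (fn (S n) x - fn n x) <= q ^ n).
  { induction n as [| n IH]; intros x.
    - simpl. rewrite Rminus_0_r. apply F0.
    - apply (Fcontr (fn (S n)) (fn n)); auto. }
  assert (fn_dist : forall n k x, Rabs (fn (n + k)%nat x - fn n x) <= (q ^ n - q ^ (n + k)) / (1 - q)).
  { intros n k x. induction k as [| k IH].
    - rewrite Nat.add_0_r, !Rminus_diag, Rabs_R0. unfold Rdiv. lra.
    - rewrite Nat.add_succ_r.
      replace (fn (S (n + k)) x - fn n x)
        with ((fn (S (n + k)) x - fn (n + k)%nat x) + (fn (n + k)%nat x - fn n x)) by ring.
      apply Rle_trans with (1 := Rabs_triang _ _).
      replace ((q ^ n - q ^ S (n + k)) / (1 - q))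
        with (q ^ (n + k) + (q ^ n - q ^ (n + k)) / (1 - q)) by (simpl; field; lra).
      apply Rplus_le_compat; auto. }
  assert (Hcvu : CVU_dom fn (fun _ => True)).
  { apply CVU_dom_cauchy. intros eps.
    assert (Hgeom : is_lim_seq (fun n => q ^ n / (1 - q)) 0).
    { replace (Finite 0) with (Finite (0 / (1 - q))) by (f_equal; field; lra).
      apply is_lim_seq_div'; [| apply is_lim_seq_const | lra].
      apply is_lim_seq_geom. rewrite Rabs_right; lra. }
    apply is_lim_seq_spec in Hgeom. destruct (Hgeom eps) as [N HN].
    exists N.
    assert (Hle : forall n k x, (N <= n)%nat -> Rabs (fn (n + k)%nat x - fn n x) < eps).
    { intros n k x Hn. apply Rle_lt_trans with (1 := fn_dist n k x).
      apply Rle_lt_trans with (2 := HN n Hn). rewrite Rminus_0_r.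
      apply Rle_trans with (2 := Rle_abs _).
      apply Rmult_le_compat_r; [left; apply Rinv_0_lt_compat; lra |].
      assert (0 <= q ^ (n + k)) by (apply pow_le; lra). lra. }
    intros n m x _ Hn Hm.
    destruct (Nat.le_ge_cases n m) as [H | H].
    - replace m with (n + (m - n))%nat by lia. rewrite Rabs_minus_sym. now apply Hle.
    - replace n with (m + (n - m))%nat by lia. now apply Hle. }
  pose (f := fun x => real (Lim_seq (fun n => fn n x))).
  assert (f_cont : forall x, continuous f x).
  { intros x. apply continuity_pt_filterlim.
    apply (CVU_cont_open fn (fun _ => True)); auto using open_true.
    intros n y _. apply continuity_pt_filterlim. apply fn_cont. }
  exists f. split; [exact f_cont |].
  intros x. apply Rminus_diag_uniq.
  apply Rabs_eq_0. apply Rle_antisym; [| apply Rabs_pos].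
  apply le_epsilon. intros eps Heps.
  assert (He2 : 0 < eps / 2) by lra.
  destruct (Hcvu (mkposreal _ He2)) as [N HN]. simpl in HN.
  assert (H1 : Rabs (F f x - F (fn N) x) <= q * (eps / 2)).
  { apply Fcontr; auto. intros y. rewrite Rabs_minus_sym. left. apply HN; auto. }
  assert (H2 : Rabs (fn (S N) x - f x) < eps / 2) by (apply HN; auto).
  (* [fn (S N)] is [F (fn N)] by definition, so both gaps are controlled by the uniform closeness of
     the iterates to [f]. *)
  replace (F f x - f x) with ((F f x - F (fn N) x) + (fn (S N) x - f x)) by (simpl; ring).
  apply Rle_trans with (1 := Rabs_triang _ _). nra.
Qed.

(** Constant temperatures belong to [in_C], and the sup norm of a constant is its absolute value, so
    the hypotheses on function spaces specialise to pointwise bounds on the coefficient. *)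
Lemma coef_hyp_bounds (h : R -> R) (hm hM hlip : R) :
  coef_hyp h hm hM hlip ->
  (forall tau, hm <= h tau <= hM) /\
  (forall tau1 tau2, Rabs (h tau1 - h tau2) <= hlip * Rabs (tau1 - tau2)).
Proof.
  intros [Hbnd Hlip].
  assert (Hin : forall tau, in_C (fun _ _ => tau)).
  { intros tau. split.
    - apply continuous_on_forall. intros; apply continuous_const.
    - exists (Rabs tau). intros; lra. }
  assert (Hsup : forall r, sup_norm (fun _ _ => r) = Rabs r).
  { intros r. apply is_lub_Rbar_unique. split.
    - intros y (x & t & _ & ->). simpl. lra.
    - intros l Hl. apply Hl. exists 0, 1. repeat split; simpl; lra. }
  split.
  - intros tau. apply (Hbnd _ (Hin tau) 0 1). split; simpl; lra.
  - intros tau1 tau2. assert (H := Hlip _ _ (Hin tau1) (Hin tau2)).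
    cbv beta in H. rewrite !Hsup in H. exact H.
Qed.

(** Inserts [a1 / l2]. The right-hand side is kept over [m ^ 2] because that is the shape of [D1],
    [D2] and [D4], with [m] equal to [L_m]. *)
Lemma abs_div_diff_le (a1 a2 l1 l2 A m : R) :
  0 < m -> m <= l1 -> m <= l2 -> Rabs a1 <= A ->
  Rabs (a1 / l1 - a2 / l2) <= (A * Rabs (l1 - l2) + m * Rabs (a1 - a2)) / m ^ 2.
Proof.
  intros Hm H1 H2 HA.
  replace (a1 / l1 - a2 / l2) with (a1 * (l2 - l1) / (l1 * l2) + (a1 - a2) / l2) by (field; lra).
  replace ((A * Rabs (l1 - l2) + m * Rabs (a1 - a2)) / m ^ 2)
    with (A * Rabs (l1 - l2) / (m * m) + Rabs (a1 - a2) / m) by (field; lra).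
  apply Rle_trans with (1 := Rabs_triang _ _).
  assert (Hml : m * m <= l1 * l2) by (apply Rmult_le_compat; lra).
  assert (Hmm : 0 < m * m) by nra.
  rewrite !Rabs_div by nra.
  rewrite (Rabs_right l2) by lra. rewrite (Rabs_right (l1 * l2)) by nra.
  rewrite Rabs_mult, (Rabs_minus_sym l2).
  apply Rplus_le_compat.
  - apply Rmult_le_compat.
    + apply Rmult_le_pos; apply Rabs_pos.
    + left. apply Rinv_0_lt_compat. lra.
    + apply Rmult_le_compat_r; [apply Rabs_pos | exact HA].
    + apply Rinv_le_contravar; lra.
  - apply Rmult_le_compat_l; [apply Rabs_pos |]. apply Rinv_le_contravar; lra.
Qed.

(** A ratio [a2 / l2] in [[0, 1]] absorbs one denominator, so only the first power of [l1] remains.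
    This is what later lets the interval length cancel. *)
Lemma abs_ratio_diff_le (a1 a2 l1 l2 : R) : 0 < l1 -> 0 < l2 -> 0 <= a2 <= l2 ->
  Rabs (a1 / l1 - a2 / l2) <= (Rabs (a1 - a2) + Rabs (l1 - l2)) / l1.
Proof.
  intros H1 H2 Ha.
  replace (a1 / l1 - a2 / l2) with ((a1 - a2) / l1 + a2 / l2 * ((l2 - l1) / l1)) by (field; lra).
  apply Rle_trans with (1 := Rabs_triang _ _).
  rewrite Rabs_mult, !Rabs_div by lra. rewrite (Rabs_right l1), (Rabs_right l2), (Rabs_right a2) by lra.
  rewrite (Rabs_minus_sym l2). unfold Rdiv at 4. rewrite Rmult_plus_distr_r.
  apply Rplus_le_compat_l. rewrite <- (Rmult_1_l (Rabs (l1 - l2) * / l1)).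
  apply Rmult_le_compat_r.
  - apply Rmult_le_pos; [apply Rabs_pos | left; now apply Rinv_0_lt_compat].
  - apply Rle_div_l; lra.
Qed.

Lemma continuous_linear (a x : R) : continuous (fun y => y * a) x.
Proof. apply (continuous_mult (K := R_AbsRing) (fun y => y)); [apply continuous_id | apply continuous_const]. Qed.

Lemma is_derive_linear (a x : R) : is_derive (fun y => y * a) x a.
Proof. auto_derive; trivial. ring. Qed.

(** * Extension of profiles *)

(** For [0 <= lam], the retraction of the line onto [[0, lam]]. Precomposing with it makes a
    function continuous on [[0, lam]] continuous everywhere, so integrability and differentiability
    of primitives hold without side conditions. *)
Definition clamp (lam x : R) : R := Rmax 0 (Rmin lam x).

Lemma clamp_in (lam x : R) : 0 <= lam -> 0 <= clamp lam x <= lam.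
Proof.
  intros H. unfold clamp. split; [apply Rmax_l |].
  apply Rmax_lub; [exact H | apply Rmin_l].
Qed.

Lemma clamp_id (lam x : R) : 0 <= x <= lam -> clamp lam x = x.
Proof. intros H. unfold clamp. rewrite Rmin_right, Rmax_right; lra. Qed.

Lemma clamp_above (lam x : R) : 0 <= lam <= x -> clamp lam x = lam.
Proof. intros H. unfold clamp. rewrite Rmin_left, Rmax_right; lra. Qed.

Lemma clamp_lipschitz (lam x y : R) : Rabs (clamp lam y - clamp lam x) <= 1 * Rabs (y - x).
Proof.
  rewrite Rmult_1_l. unfold clamp, Rmax, Rmin.
  repeat destruct Rle_dec; unfold Rabs; repeat destruct Rcase_abs; lra.
Qed.

Lemma continuous_clamp (lam x : R) : continuous (clamp lam) x.
Proof. apply lipschitz_continuous with 1. apply clamp_lipschitz. Qed.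

Lemma continuous_comp_clamp (lam : R) (h : R -> R) (x : R) :
  0 <= lam -> C0 lam h -> continuous (fun y => h (clamp lam y)) x.
Proof.
  intros Hlam Hh. intros P HP.
  assert (H := Hh (clamp lam x) (clamp_in lam x Hlam) P HP).
  assert (H' := continuous_clamp lam x _ H).
  unfold filtermap in *. apply filter_imp with (2 := H').
  intros y Hy. now apply Hy, clamp_in.
Qed.

(** Locality: the operators see only [[0, z]], so the choice of an extension beyond the interval is
    harmless. *)
Lemma Efun_ext (d : stefan_data) (f g : R -> R) (z : R) : 0 <= z ->
  (forall x, 0 <= x <= z -> f x = g x) -> Efun d f z = Efun d g z.
Proof.
  intros Hz Hfg. unfold Efun, Ufun, Ifun.
  replace (RInt (fun s => mustar d f s / Lstar d f s) 0 z)
    with (RInt (fun s => mustar d g s / Lstar d g s) 0 z).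
  replace (RInt (fun s => s * Nstar d f s / Lstar d f s) 0 z)
    with (RInt (fun s => s * Nstar d g s / Lstar d g s) 0 z).
  reflexivity.
  all: apply RInt_ext; rewrite Rmin_left, Rmax_right by lra; intros x Hx;
    unfold mustar, Nstar, Lstar, temp; now rewrite Hfg by lra.
Qed.

Lemma Phi_ext (d : stefan_data) (f g : R -> R) (z : R) : 0 <= z ->
  (forall x, 0 <= x <= z -> f x = g x) -> Phi d f z = Phi d g z.
Proof.
  intros Hz Hfg. apply RInt_ext. rewrite Rmin_left, Rmax_right by lra.
  intros x Hx. rewrite (Efun_ext d f g x) by (intros; try apply Hfg; lra).
  unfold Lstar, temp. now rewrite Hfg by lra.
Qed.

(* A profile extended by its boundary values, so as to be continuous on the whole line. *)
Definition is_extended_profile (d : stefan_data) (lam : R) (f : R -> R) : Prop :=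
  (forall x, continuous f x) /\
  forall x, f x = Phi d f (clamp lam x) / Phi d f lam.

Lemma extended_profile_of_profile (d : stefan_data) (lam : R) (h : R -> R) :
  0 < lam -> is_profile d lam h -> is_extended_profile d lam (fun x => h (clamp lam x)).
Proof.
  intros Hlam [HC Hh].
  assert (Heq : forall z, 0 <= z <= lam -> Phi d (fun x => h (clamp lam x)) z = Phi d h z).
  { intros z Hz. apply Phi_ext; [lra |]. intros x Hx. rewrite clamp_id; [trivial | lra]. }
  split.
  - intros x. apply continuous_comp_clamp; [lra | trivial].
  - intros x. assert (H := clamp_in lam x ltac:(lra)).
    rewrite !Heq by lra. now apply Hh.
Qed.

Lemma profile_of_extended_profile (d : stefan_data) (lam : R) (f : R -> R) :
  is_extended_profile d lam f -> is_profile d lam f.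
Proof.
  intros [HC Hf]. split.
  - apply continuous_on_forall. auto.
  - intros x Hx. rewrite Hf at 1. now rewrite clamp_id.
Qed.

(** * Estimates on the fixed-point operator *)

(** The interface between the hypotheses and the analysis. The difference bounds allow two functions
    and two points at once: [f = g] gives continuity of the coefficients along a profile, [x = y]
    gives their dependence on the profile. *)
Record normalized_bounds (d : stefan_data) (b : coef_bounds) : Prop := {
  nb_L_m : 0 < L_m d b;
  nb_N_m : 0 < N_m d b;
  nb_mu_M : 0 < mu_M d b;
  nb_L_lip : 0 <= L_lip d b;
  nb_N_lip : 0 <= N_lip d b;
  nb_mu_lip : 0 <= mu_lip d b;
  nb_L : forall f x, L_m d b <= Lstar d f x <= L_M d b;
  nb_N : forall f x, N_m d b <= Nstar d f x <= N_M d b;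
  nb_mu : forall f x, 0 < mustar d f x <= mu_M d b;
  nb_L_diff : forall f g x y,
    Rabs (Lstar d f x - Lstar d g y) <= L_lip d b * Rabs (f x - g y);
  nb_N_diff : forall f g x y,
    Rabs (Nstar d f x - Nstar d g y) <= N_lip d b * Rabs (f x - g y);
  nb_mu_diff : forall f g x y,
    Rabs (mustar d f x - mustar d g y) <= mu_lip d b * Rabs (f x - g y)
}.

Lemma coef_diff_normalized (d : stefan_data) (h : R -> R) (hlip r u v : R) :
  0 < r -> Tmelt d < Tstar d ->
  (forall tau1 tau2, Rabs (h tau1 - h tau2) <= hlip * Rabs (tau1 - tau2)) ->
  Rabs (h ((Tmelt d - Tstar d) * u + Tstar d) / r - h ((Tmelt d - Tstar d) * v + Tstar d) / r)
    <= hlip * (Tstar d - Tmelt d) / r * Rabs (u - v).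
Proof.
  intros Hr HT Hlip. unfold Rdiv. rewrite <- Rmult_minus_distr_r, Rabs_mult.
  rewrite (Rabs_right (/ r)) by (apply Rle_ge; left; now apply Rinv_0_lt_compat).
  replace (hlip * (Tstar d - Tmelt d) * / r * Rabs (u - v))
    with (hlip * ((Tstar d - Tmelt d) * Rabs (u - v)) * / r) by ring.
  apply Rmult_le_compat_r; [left; now apply Rinv_0_lt_compat |].
  apply Rle_trans with (1 := Hlip _ _). right. f_equal.
  rewrite <- (Rabs_right (Tstar d - Tmelt d)) at 1 by lra.
  rewrite <- Rabs_mult, Rabs_minus_sym. f_equal. ring.
Qed.

Lemma Rdiv_le_compat (r x y : R) : 0 < r -> x <= y -> x / r <= y / r.
Proof. intros Hr Hxy. apply Rmult_le_compat_r; [left; now apply Rinv_0_lt_compat | exact Hxy]. Qed.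

Lemma normalized_bounds_of_hyp (d : stefan_data) (b : coef_bounds) :
  data_admissible d -> bounds_positive b -> hyp_K d b -> hyp_R d b -> hyp_V d b ->
  normalized_bounds d b.
Proof.
  intros (HT & Hrho & Hc & Hk & _) ((Hk1 & Hk2 & Hk3) & (Hg1 & Hg2 & Hg3) & (Hn1 & Hn2 & Hn3))
    HK HR HV.
  apply coef_hyp_bounds in HK, HR, HV.
  destruct HK as [HK1 HK2], HR as [HR1 HR2], HV as [HV1 HV2].
  assert (Hrc : 0 < rho0 d * c0 d) by now apply Rmult_lt_0_compat.
  assert (Hs : 0 < sqrt (rho0 d * c0 d * k0 d)).
  { apply sqrt_lt_R0. now apply Rmult_lt_0_compat. }
  constructor.
  - now apply Rdiv_lt_0_compat.
  - now apply Rdiv_lt_0_compat.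
  - now apply Rdiv_lt_0_compat.
  - apply Rdiv_le_0_compat; [apply Rmult_le_pos |]; lra.
  - apply Rdiv_le_0_compat; [apply Rmult_le_pos |]; lra.
  - apply Rdiv_le_0_compat; [apply Rmult_le_pos |]; lra.
  - intros f x. split; apply Rdiv_le_compat; trivial; apply HK1.
  - intros f x. split; apply Rdiv_le_compat; trivial; apply HR1.
  - intros f x. destruct (HV1 (temp d f x)) as [H1 H2]. split.
    + apply Rdiv_lt_0_compat; lra.
    + now apply Rdiv_le_compat.
  - intros f g x y. now apply coef_diff_normalized.
  - intros f g x y. now apply (coef_diff_normalized d (coef_rhoc d)).
  - intros f g x y. now apply coef_diff_normalized.
Qed.

Section Estimates.

Context (d : stefan_data) (b : coef_bounds) (nb : normalized_bounds d b).

Local Notation Lm := (L_m d b).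
Local Notation LM := (L_M d b).
Local Notation Nm := (N_m d b).
Local Notation NM := (N_M d b).
Local Notation muM := (mu_M d b).

Lemma Lm_pos : 0 < Lm.
Proof. apply nb. Qed.

Lemma LM_pos : 0 < LM.
Proof. assert (H := nb_L d b nb (fun _ => 0) 0). assert (H1 := Lm_pos). lra. Qed.

Lemma muM_pos : 0 < muM.
Proof. apply nb. Qed.

Lemma Nm_pos : 0 < Nm.
Proof. apply nb. Qed.

Lemma NM_pos : 0 < NM.
Proof. assert (H := nb_N d b nb (fun _ => 0) 0). assert (H1 := Nm_pos). lra. Qed.

Lemma Lstar_pos (f : R -> R) (x : R) : 0 < Lstar d f x.
Proof. assert (H := nb_L d b nb f x). assert (H1 := Lm_pos). lra. Qed.

Section Continuous.

Context (f : R -> R) (Cf : forall x, continuous f x).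

Lemma continuous_Lstar (x : R) : continuous (Lstar d f) x.
Proof. apply continuous_of_dominated with (f := f) (K := L_lip d b); auto. intros; apply nb. Qed.

Lemma continuous_Nstar (x : R) : continuous (Nstar d f) x.
Proof. apply continuous_of_dominated with (f := f) (K := N_lip d b); auto. intros; apply nb. Qed.

Lemma continuous_mustar (x : R) : continuous (mustar d f) x.
Proof. apply continuous_of_dominated with (f := f) (K := mu_lip d b); auto. intros; apply nb. Qed.

Lemma continuous_div_Lstar (g : R -> R) (x : R) :
  continuous g x -> continuous (fun z => g z / Lstar d f z) x.
Proof.
  intros Hg. apply (continuous_mult (K := R_AbsRing)); [exact Hg |].
  apply continuous_Rinv_comp; [apply continuous_Lstar |].
  apply Rgt_not_eq, Lstar_pos.
Qed.

Lemma continuous_U_integrand (x : R) :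
  continuous (fun z => mustar d f z / Lstar d f z) x.
Proof. apply continuous_div_Lstar, continuous_mustar. Qed.

Lemma continuous_I_integrand (x : R) :
  continuous (fun z => z * Nstar d f z / Lstar d f z) x.
Proof.
  apply (continuous_div_Lstar (fun z => z * Nstar d f z)).
  apply (continuous_mult (K := R_AbsRing) (fun z => z)); [apply continuous_id | apply continuous_Nstar].
Qed.

Lemma U_integrand_bounds (x : R) : 0 < mustar d f x / Lstar d f x <= muM / Lm.
Proof.
  assert (H1 := nb_L d b nb f x). assert (H2 := nb_mu d b nb f x). assert (H3 := Lm_pos).
  split.
  - apply Rdiv_lt_0_compat; [lra | apply Lstar_pos].
  - apply Rmult_le_compat; try lra.
    + left. apply Rinv_0_lt_compat, Lstar_pos.
    + apply Rinv_le_contravar; [exact H3 | lra].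
Qed.

Lemma I_integrand_bounds (x : R) : 0 <= x ->
  x * (Nm / LM) <= x * Nstar d f x / Lstar d f x <= x * (NM / Lm).
Proof.
  intros Hx. assert (H1 := nb_L d b nb f x). assert (H2 := nb_N d b nb f x).
  assert (H3 := Lm_pos). assert (H4 := Nm_pos).
  unfold Rdiv. rewrite Rmult_assoc.
  split; apply Rmult_le_compat_l; trivial; apply Rmult_le_compat; try lra.
  - left. apply Rinv_0_lt_compat. lra.
  - apply Rinv_le_contravar; lra.
  - left. apply Rinv_0_lt_compat. lra.
  - apply Rinv_le_contravar; lra.
Qed.

Lemma Ufun_bounds (z : R) : 0 <= z -> 1 <= Ufun d f z <= exp (2 * z * (muM / Lm)).
Proof.
  intros Hz. split.
  - rewrite <- exp_0. apply exp_le. apply Rmult_le_pos; [lra |].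
    apply RInt_ge_0; trivial.
    + apply ex_RInt_continuous_global, continuous_U_integrand.
    + intros x _. left. apply U_integrand_bounds.
  - apply exp_le. rewrite Rmult_assoc. apply Rmult_le_compat_l; [lra |].
    replace (z * (muM / Lm)) with (z * (muM / Lm) - 0 * (muM / Lm)) by ring.
    apply (RInt_le_antiderivative _ (fun y => y * (muM / Lm)) (fun _ => muM / Lm)); trivial.
    + apply continuous_U_integrand.
    + intros x. apply continuous_const.
    + apply is_derive_linear.
    + intros x _. apply U_integrand_bounds.
Qed.

Lemma Ufun_gt_1 (z : R) : 0 < z -> 1 < Ufun d f z.
Proof.
  intros Hz. rewrite <- exp_0. apply exp_increasing. apply Rmult_lt_0_compat; [lra |].
  apply RInt_gt_0; trivial.
  - intros x _. apply U_integrand_bounds.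
  - intros x _. apply continuous_U_integrand.
Qed.

Lemma Ifun_bounds (z : R) : 0 <= z ->
  exp (z ^ 2 * (Nm / LM)) <= Ifun d f z <= exp (z ^ 2 * (NM / Lm)).
Proof.
  intros Hz.
  assert (HG : forall a x, is_derive (fun y => y ^ 2 / 2 * a) x (x * a)).
  { intros a x. auto_derive; trivial. field. }
  split; apply exp_le.
  - replace (z ^ 2 * (Nm / LM)) with (2 * (z ^ 2 / 2 * (Nm / LM) - 0 ^ 2 / 2 * (Nm / LM))) by lra.
    apply Rmult_le_compat_l; [lra |].
    apply (RInt_ge_antiderivative _ (fun y => y ^ 2 / 2 * (Nm / LM)) (fun y => y * (Nm / LM)));
      auto using continuous_I_integrand, continuous_linear.
    intros x Hx. apply I_integrand_bounds. lra.
  - replace (z ^ 2 * (NM / Lm)) with (2 * (z ^ 2 / 2 * (NM / Lm) - 0 ^ 2 / 2 * (NM / Lm))) by lra.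
    apply Rmult_le_compat_l; [lra |].
    apply (RInt_le_antiderivative _ (fun y => y ^ 2 / 2 * (NM / Lm)) (fun y => y * (NM / Lm)));
      auto using continuous_I_integrand, continuous_linear.
    intros x Hx. apply I_integrand_bounds. lra.
Qed.

Lemma Ifun_ge_1 (z : R) : 0 <= z -> 1 <= Ifun d f z.
Proof.
  intros Hz. apply Rle_trans with (2 := proj1 (Ifun_bounds z Hz)).
  rewrite <- exp_0. apply exp_le. apply Rmult_le_pos; [apply pow2_ge_0 |].
  apply Rdiv_le_0_compat; [left; apply Nm_pos | apply LM_pos].
Qed.

(** [E] is a quotient of exponentials of primitives, hence solves a linear first-order equation.
    Since [Lstar] times the derivative of a profile is proportional to [E], this equation is the
    similarity form of the heat equation. *)
Lemma is_derive_Efun (z : R) :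
  is_derive (Efun d f) z
    (Efun d f z * (2 * (mustar d f z / Lstar d f z) - 2 * (z * Nstar d f z / Lstar d f z))).
Proof.
  (* Stated for abstract exponents, so that differentiation does not enter the integrals. *)
  assert (Hquot : forall (P Q : R -> R) p q, is_derive P z p -> is_derive Q z q ->
    is_derive (fun z => exp (2 * P z) / exp (2 * Q z)) z
      (exp (2 * P z) / exp (2 * Q z) * (2 * p - 2 * q))).
  { intros P Q p q HP HQ. auto_derive.
    - repeat split; try (now eexists; eassumption). apply Rgt_not_eq, exp_pos.
    - assert (DP : Derive (fun x : R => P x) z = p) by exact (is_derive_unique _ _ _ HP).
      assert (DQ : Derive (fun x : R => Q x) z = q) by exact (is_derive_unique _ _ _ HQ).
      rewrite DP, DQ. field. apply Rgt_not_eq, exp_pos. }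
  exact (Hquot _ _ _ _ (is_derive_primitive _ z continuous_U_integrand)
                       (is_derive_primitive _ z continuous_I_integrand)).
Qed.

Lemma continuous_Efun (z : R) : continuous (Efun d f) z.
Proof. apply (ex_derive_continuous (V := R_NormedModule)). eexists. apply is_derive_Efun. Qed.

Lemma continuous_Phi_integrand (z : R) : continuous (fun z => Efun d f z / Lstar d f z) z.
Proof. exact (continuous_div_Lstar (Efun d f) z (continuous_Efun z)). Qed.

Lemma is_derive_Phi (z : R) : is_derive (Phi d f) z (Efun d f z / Lstar d f z).
Proof. exact (is_derive_primitive _ z continuous_Phi_integrand). Qed.

Lemma continuous_Phi (z : R) : continuous (Phi d f) z.
Proof. apply (ex_derive_continuous (V := R_NormedModule)). eexists. apply is_derive_Phi. Qed.

Lemma Efun_pos (z : R) : 0 < Efun d f z.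
Proof. apply Rdiv_lt_0_compat; apply exp_pos. Qed.

Lemma Efun_le (z : R) : 0 <= z -> Efun d f z <= exp (2 * z * (muM / Lm)).
Proof.
  intros Hz. assert (H1 := Ufun_bounds z Hz). assert (H2 := Ifun_ge_1 z Hz).
  unfold Efun. apply Rle_div_l; nra.
Qed.

Lemma Efun_ge (z : R) : 0 <= z -> exp (- (z ^ 2 * (NM / Lm))) <= Efun d f z.
Proof.
  intros Hz. assert (H1 := Ufun_bounds z Hz). assert (H2 := Ifun_bounds z Hz).
  rewrite exp_Ropp. unfold Efun. rewrite <- (Rmult_1_l (/ _)).
  apply Rmult_le_compat; try lra.
  - left. apply Rinv_0_lt_compat, exp_pos.
  - apply Rinv_le_contravar; [apply exp_pos | apply H2].
Qed.

Lemma Phi_le (z w : R) : 0 <= z <= w -> Phi d f z <= Phi d f w.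
Proof.
  intros Hzw. destruct (MVT_gen (Phi d f) z w (fun z => Efun d f z / Lstar d f z)) as (c & _ & Hc).
  - intros; apply is_derive_Phi.
  - intros. apply continuity_pt_filterlim, continuous_Phi.
  - assert (0 < Efun d f c / Lstar d f c) by (apply Rdiv_lt_0_compat; [apply Efun_pos | apply Lstar_pos]).
    nra.
Qed.

Lemma Phi_0 : Phi d f 0 = 0.
Proof. apply (RInt_point (V := R_CompleteNormedModule)). Qed.

(** Linear in [z], with one slope for all lengths up to [Z]. The reciprocal of the slope is the
    factor [L_M * exp (N_M / L_m * Z ^ 2)] of [Ecal]. *)
Lemma Phi_ge (Z z : R) : 0 <= z <= Z -> z * (exp (- (Z ^ 2 * (NM / Lm))) / LM) <= Phi d f z.
Proof.
  intros Hz.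
  replace (z * (exp (- (Z ^ 2 * (NM / Lm))) / LM))
    with (z * (exp (- (Z ^ 2 * (NM / Lm))) / LM) - 0 * (exp (- (Z ^ 2 * (NM / Lm))) / LM)) by ring.
  apply (RInt_ge_antiderivative _ (fun y => y * (exp (- (Z ^ 2 * (NM / Lm))) / LM))
           (fun _ => exp (- (Z ^ 2 * (NM / Lm))) / LM)).
  - lra.
  - apply continuous_Phi_integrand.
  - intros; apply continuous_const.
  - apply is_derive_linear.
  - intros x Hx. apply Rmult_le_compat.
    + left; apply exp_pos.
    + left; apply Rinv_0_lt_compat, LM_pos.
    + apply Rle_trans with (2 := Efun_ge x (proj1 Hx)). apply exp_le.
      apply Ropp_le_contravar, Rmult_le_compat_r.
      * apply Rdiv_le_0_compat; [left; apply NM_pos | apply Lm_pos].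
      * apply pow_incr. lra.
    + apply Rinv_le_contravar; [apply Lstar_pos | apply nb].
Qed.

Lemma Phi_pos (z : R) : 0 < z -> 0 < Phi d f z.
Proof.
  intros Hz. apply Rlt_le_trans with (2 := Phi_ge z z ltac:(lra)).
  apply Rmult_lt_0_compat; trivial. apply Rdiv_lt_0_compat; [apply exp_pos | apply LM_pos].
Qed.

End Continuous.

Section Difference.

(** Two lengths are kept apart: closeness is assumed only on [[0, w]], while the majorants are
    evaluated at [Z >= w] and so do not depend on [w]. *)
Context (f g : R -> R) (Cf : forall x, continuous f x) (Cg : forall x, continuous g x)
  (Z w delta : R) (HwZ : w <= Z) (Hdelta : 0 <= delta)
  (Hfg : forall x, 0 <= x <= w -> Rabs (f x - g x) <= delta).

Lemma Ufun_diff_le (z : R) : 0 <= z <= w -> Rabs (Ufun d f z - Ufun d g z) <= D1 d b Z * delta.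
Proof.
  intros Hz. assert (HLm := Lm_pos). assert (Hmu := muM_pos).
  assert (HLl := nb_L_lip d b nb). assert (Hml := nb_mu_lip d b nb).
  (* Lipschitz constant of [mustar / Lstar] in the profile; [D1 d b Z] is [2 * Z * cP] times the
     largest value allowed for [U]. *)
  pose (cP := (muM * L_lip d b + Lm * mu_lip d b) / Lm ^ 2).
  assert (HcP : 0 <= cP) by (apply Rdiv_le_0_compat; nra).
  assert (HR : Rabs (RInt (fun s => mustar d f s / Lstar d f s) 0 z
                     - RInt (fun s => mustar d g s / Lstar d g s) 0 z) <= z * (cP * delta)).
  { replace (z * (cP * delta)) with (z * (cP * delta) - 0 * (cP * delta)) by ring.
    apply (RInt_diff_le_antiderivative _ _ (fun y => y * (cP * delta)) (fun _ => cP * delta)).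
    - lra.
    - now apply continuous_U_integrand.
    - now apply continuous_U_integrand.
    - intros; apply continuous_const.
    - apply is_derive_linear.
    - intros x Hx.
      apply Rle_trans with ((muM * Rabs (Lstar d f x - Lstar d g x)
                             + Lm * Rabs (mustar d f x - mustar d g x)) / Lm ^ 2).
      + apply abs_div_diff_le; try apply nb.
        rewrite Rabs_right; [apply nb | apply Rle_ge; left; apply nb].
      + replace (cP * delta) with ((muM * (L_lip d b * delta) + Lm * (mu_lip d b * delta)) / Lm ^ 2)
          by (unfold cP; field; lra).
        assert (H0 := Hfg x ltac:(lra)).
        apply Rdiv_le_compat; [nra |].
        apply Rplus_le_compat; apply Rmult_le_compat_l; try lra.
        * apply Rle_trans with (1 := nb_L_diff d b nb f g x x). now apply Rmult_le_compat_l.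
        * apply Rle_trans with (1 := nb_mu_diff d b nb f g x x). now apply Rmult_le_compat_l. }
  apply Rle_trans with (exp (2 * Z * (muM / Lm)) * (2 * (Z * (cP * delta)))).
  - assert (Hmono : 2 * z * (muM / Lm) <= 2 * Z * (muM / Lm)).
    { apply Rmult_le_compat_r; [apply Rdiv_le_0_compat |]; lra. }
    (* The bounds on the two exponents are read off from [Ufun_bounds] by inverting [exp]. *)
    apply Rle_trans with (1 := abs_exp_diff_le (2 * Z * (muM / Lm)) _ _
      ltac:(apply exp_le_inv, Rle_trans with (1 := proj2 (Ufun_bounds f Cf z (proj1 Hz))), exp_le, Hmono)
      ltac:(apply exp_le_inv, Rle_trans with (1 := proj2 (Ufun_bounds g Cg z (proj1 Hz))), exp_le, Hmono)).
    apply Rmult_le_compat_l; [left; apply exp_pos |].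
    rewrite <- Rmult_minus_distr_l, Rabs_mult, (Rabs_right 2) by lra.
    apply Rmult_le_compat_l; [lra |]. apply Rle_trans with (1 := HR).
    apply Rmult_le_compat_r; [now apply Rmult_le_pos | lra].
  - right. unfold D1, cP. replace (2 * muM * Z / Lm) with (2 * Z * (muM / Lm)) by (field; lra).
    field. lra.
Qed.

(** As for [U], except that the weight [s] integrates to [z ^ 2 / 2]; the half cancels the 2 in the
    exponent, which is why [D2] has no leading 2. *)
Lemma Ifun_diff_le (z : R) : 0 <= z <= w -> Rabs (Ifun d f z - Ifun d g z) <= D2 d b Z * delta.
Proof.
  intros Hz. assert (HLm := Lm_pos). assert (HNM := NM_pos).
  assert (HLl := nb_L_lip d b nb). assert (HNl := nb_N_lip d b nb).
  pose (cQ := (NM * L_lip d b + Lm * N_lip d b) / Lm ^ 2).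
  assert (HcQ : 0 <= cQ) by (apply Rdiv_le_0_compat; nra).
  assert (HcQd : 0 <= cQ * delta) by now apply Rmult_le_pos.
  assert (HR : Rabs (RInt (fun s => s * Nstar d f s / Lstar d f s) 0 z
                     - RInt (fun s => s * Nstar d g s / Lstar d g s) 0 z) <= z ^ 2 / 2 * (cQ * delta)).
  { replace (z ^ 2 / 2 * (cQ * delta))
      with (z ^ 2 / 2 * (cQ * delta) - 0 ^ 2 / 2 * (cQ * delta)) by (field; lra).
    apply (RInt_diff_le_antiderivative _ _ (fun y => y ^ 2 / 2 * (cQ * delta)) (fun y => y * (cQ * delta))).
    - lra.
    - now apply continuous_I_integrand.
    - now apply continuous_I_integrand.
    - apply continuous_linear.
    - intros x. generalize (cQ * delta). intros a. auto_derive; trivial. field.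
    - intros x Hx.
      replace (x * Nstar d f x / Lstar d f x - x * Nstar d g x / Lstar d g x)
        with (x * (Nstar d f x / Lstar d f x - Nstar d g x / Lstar d g x))
        by (field; split; apply Rgt_not_eq, Lstar_pos).
      rewrite Rabs_mult, (Rabs_right x) by lra. apply Rmult_le_compat_l; [lra |].
      apply Rle_trans with ((NM * Rabs (Lstar d f x - Lstar d g x)
                             + Lm * Rabs (Nstar d f x - Nstar d g x)) / Lm ^ 2).
      + apply abs_div_diff_le; try apply nb.
        assert (H1 := nb_N d b nb f x). assert (H2 := Nm_pos). rewrite Rabs_right; lra.
      + replace (cQ * delta) with ((NM * (L_lip d b * delta) + Lm * (N_lip d b * delta)) / Lm ^ 2)
          by (unfold cQ; field; lra).
        assert (H0 := Hfg x ltac:(lra)).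
        apply Rdiv_le_compat; [nra |].
        apply Rplus_le_compat; apply Rmult_le_compat_l; try lra.
        * apply Rle_trans with (1 := nb_L_diff d b nb f g x x). now apply Rmult_le_compat_l.
        * apply Rle_trans with (1 := nb_N_diff d b nb f g x x). now apply Rmult_le_compat_l. }
  assert (Hz2 : z ^ 2 <= Z ^ 2) by (apply pow_incr; lra).
  apply Rle_trans with (exp (Z ^ 2 * (NM / Lm)) * (2 * (Z ^ 2 / 2 * (cQ * delta)))).
  - assert (Hmono : z ^ 2 * (NM / Lm) <= Z ^ 2 * (NM / Lm)).
    { apply Rmult_le_compat_r; [apply Rdiv_le_0_compat |]; lra. }
    apply Rle_trans with (1 := abs_exp_diff_le (Z ^ 2 * (NM / Lm)) _ _
      ltac:(apply exp_le_inv, Rle_trans with (1 := proj2 (Ifun_bounds f Cf z (proj1 Hz))), exp_le, Hmono)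
      ltac:(apply exp_le_inv, Rle_trans with (1 := proj2 (Ifun_bounds g Cg z (proj1 Hz))), exp_le, Hmono)).
    apply Rmult_le_compat_l; [left; apply exp_pos |].
    rewrite <- Rmult_minus_distr_l, Rabs_mult, (Rabs_right 2) by lra.
    apply Rmult_le_compat_l; [lra |]. apply Rle_trans with (1 := HR).
    apply Rmult_le_compat_r; [trivial | lra].
  - right. unfold D2, cQ. replace (NM * Z ^ 2 / Lm) with (Z ^ 2 * (NM / Lm)) by (field; lra).
    field. lra.
Qed.

Lemma D1_nonneg : 0 <= Z -> 0 <= D1 d b Z.
Proof.
  intros HZ. assert (HLm := Lm_pos). assert (Hmu := muM_pos).
  assert (HLl := nb_L_lip d b nb). assert (Hml := nb_mu_lip d b nb).
  apply Rmult_le_pos; [| nra]. apply Rmult_le_pos; trivial.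
  apply Rdiv_le_0_compat; [| nra]. apply Rmult_le_pos; [lra | left; apply exp_pos].
Qed.

Lemma Efun_le_uniform (h : R -> R) (z : R) : (forall x, continuous h x) -> 0 <= z <= Z ->
  Rabs (Efun d h z) <= exp (2 * Z * (muM / Lm)).
Proof.
  intros Ch Hz. rewrite Rabs_right by (apply Rle_ge; left; apply Efun_pos).
  apply Rle_trans with (1 := Efun_le h Ch z (proj1 Hz)). apply exp_le.
  assert (HLm := Lm_pos). assert (Hmu := muM_pos).
  apply Rmult_le_compat_r; [apply Rdiv_le_0_compat |]; lra.
Qed.

(** Because [I >= 1], the quotient estimate applies with lower bound 1. The factor of [D1] inside
    [D3] is at least 1 and is inserted by [H7]. *)
Lemma Efun_diff_le (z : R) : 0 <= z <= w -> Rabs (Efun d f z - Efun d g z) <= D3 d b Z * delta.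
Proof.
  intros Hz. assert (HLm := Lm_pos). assert (Hmu := muM_pos). assert (HNM := NM_pos).
  assert (HU : Rabs (Ufun d f z) <= exp (2 * Z * (muM / Lm))).
  { assert (H := Ufun_bounds f Cf z ltac:(lra)). rewrite Rabs_right by lra.
    apply Rle_trans with (1 := proj2 H). apply exp_le.
    apply Rmult_le_compat_r; [apply Rdiv_le_0_compat |]; lra. }
  apply Rle_trans with (1 := abs_div_diff_le _ _ _ _ _ 1 Rlt_0_1
    (Ifun_ge_1 f Cf z (proj1 Hz)) (Ifun_ge_1 g Cg z (proj1 Hz)) HU).
  assert (H1 := Ufun_diff_le z Hz). assert (H2 := Ifun_diff_le z Hz).
  assert (H3 : 1 <= exp (NM / Lm * Z ^ 2)).
  { rewrite <- exp_0. apply exp_le, Rmult_le_pos; [apply Rdiv_le_0_compat; lra | apply pow2_ge_0]. }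
  assert (H4 := D1_nonneg ltac:(lra)).
  unfold D3. replace (2 * (muM / Lm) * Z) with (2 * Z * (muM / Lm)) by ring.
  assert (H5 := exp_pos (2 * Z * (muM / Lm))).
  assert (H6 : exp (2 * Z * (muM / Lm)) * Rabs (Ifun d f z - Ifun d g z)
               <= exp (2 * Z * (muM / Lm)) * (D2 d b Z * delta)) by (apply Rmult_le_compat_l; lra).
  assert (H7 : 1 * (D1 d b Z * delta) <= exp (NM / Lm * Z ^ 2) * (D1 d b Z * delta)).
  { apply Rmult_le_compat_r; trivial. now apply Rmult_le_pos. }
  unfold Rdiv. rewrite pow1, Rinv_1. lra.
Qed.

Lemma Phi_integrand_diff_le (z : R) : 0 <= z <= w ->
  Rabs (Efun d f z / Lstar d f z - Efun d g z / Lstar d g z) <= D4 d b Z * delta.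
Proof.
  intros Hz. assert (HLm := Lm_pos).
  assert (HzZ : 0 <= z <= Z) by lra.
  apply Rle_trans with (1 := abs_div_diff_le _ _ _ _ _ Lm HLm
    (proj1 (nb_L d b nb f z)) (proj1 (nb_L d b nb g z)) (Efun_le_uniform f z Cf HzZ)).
  replace (D4 d b Z * delta)
    with ((exp (2 * Z * (muM / Lm)) * (L_lip d b * delta) + Lm * (D3 d b Z * delta)) / Lm ^ 2)
    by (unfold D4; field; lra).
  apply Rdiv_le_compat; [now apply pow_lt |].
  apply Rplus_le_compat; apply Rmult_le_compat_l.
  - left; apply exp_pos.
  - apply Rle_trans with (1 := nb_L_diff d b nb f g z z).
    apply Rmult_le_compat_l; [apply nb | auto].
  - lra.
  - now apply Efun_diff_le.
Qed.

Lemma Phi_diff_le (z : R) : 0 <= z <= w ->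
  Rabs (Phi d f z - Phi d g z) <= z * (D4 d b Z * delta).
Proof.
  intros Hz.
  replace (z * (D4 d b Z * delta)) with (z * (D4 d b Z * delta) - 0 * (D4 d b Z * delta)) by ring.
  apply (RInt_diff_le_antiderivative _ _ (fun y => y * (D4 d b Z * delta)) (fun _ => D4 d b Z * delta)).
  - lra.
  - now apply continuous_Phi_integrand.
  - now apply continuous_Phi_integrand.
  - intros; apply continuous_const.
  - apply is_derive_linear.
  - intros x Hx. apply Phi_integrand_diff_le. lra.
Qed.

(** The contraction estimate. Both differences are at most [w * (D4 d b Z * delta)] and the
    denominator is at least [w * m]; the cancellation of [w] leaves [2 * D4 / m], which is
    [Ecal]. *)
Lemma Phi_ratio_diff_le (z : R) : 0 <= z <= w -> 0 < w ->
  Rabs (Phi d f z / Phi d f w - Phi d g z / Phi d g w) <= Ecal d b Z * delta.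
Proof.
  intros Hz Hw. assert (HLM := LM_pos).
  assert (Hf := Phi_pos f Cf w Hw). assert (Hg := Phi_pos g Cg w Hw).
  assert (Hgz : 0 <= Phi d g z <= Phi d g w).
  { split; [rewrite <- (Phi_0 g) |]; apply Phi_le; trivial; lra. }
  apply Rle_trans with (1 := abs_ratio_diff_le _ _ _ _ Hf Hg Hgz).
  assert (H1 := Phi_diff_le z Hz). assert (H2 := Phi_diff_le w ltac:(lra)).
  assert (H3 := Phi_ge f Cf Z w ltac:(lra)).
  (* The sign comes from the fact that this quantity dominates an absolute value. *)
  assert (H4 : 0 <= D4 d b Z * delta).
  { apply Rle_trans with (2 := Phi_integrand_diff_le z Hz). apply Rabs_pos. }
  apply Rle_div_l; trivial.
  replace (Ecal d b Z * delta)
    with (2 * (D4 d b Z * delta) / (exp (- (Z ^ 2 * (NM / Lm))) / LM)).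
  2:{ unfold Ecal. rewrite exp_Ropp. replace (NM / Lm * Z ^ 2) with (Z ^ 2 * (NM / Lm)) by ring.
      assert (HLm := Lm_pos). field. repeat split; apply Rgt_not_eq; trivial; apply exp_pos. }
  set (m := exp (- (Z ^ 2 * (NM / Lm))) / LM) in *.
  assert (Hm : 0 < m) by (apply Rdiv_lt_0_compat; [apply exp_pos | lra]).
  apply Rle_trans with (2 * (D4 d b Z * delta) / m * (w * m)).
  - replace (2 * (D4 d b Z * delta) / m * (w * m)) with (2 * (w * (D4 d b Z * delta))) by (field; lra).
    nra.
  - apply Rmult_le_compat_l; trivial. apply Rdiv_le_0_compat; lra.
Qed.

End Difference.

(** * Existence and stability of profiles *)

Lemma Phi_ratio_bounds (f : R -> R) (lam z : R) : (forall x, continuous f x) ->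
  0 < lam -> 0 <= z <= lam -> 0 <= Phi d f z / Phi d f lam <= 1.
Proof.
  intros Cf Hlam Hz. assert (H := Phi_pos f Cf lam Hlam).
  assert (H1 := Phi_le f Cf 0 z ltac:(lra)). assert (H2 := Phi_le f Cf z lam Hz).
  rewrite Phi_0 in H1. split.
  - now apply Rdiv_le_0_compat.
  - apply Rle_div_l; lra.
Qed.

(** Comparing the zero function with itself at [delta = 1] shows that [D4] dominates 0. *)
Lemma Ecal_nonneg (Z : R) : 0 <= Z -> 0 <= Ecal d b Z.
Proof.
  intros HZ. assert (C0 : forall x : R, continuous (fun _ => 0) x) by (intros; apply continuous_const).
  assert (H := Phi_integrand_diff_le (fun _ => 0) (fun _ => 0) C0 C0 Z Z 1 ltac:(lra) ltac:(lra)
    ltac:(intros; rewrite Rminus_diag, Rabs_R0; lra) 0 ltac:(lra)).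
  rewrite Rminus_diag, Rabs_R0 in H. unfold Ecal.
  apply Rmult_le_pos; [| left; apply exp_pos].
  apply Rmult_le_pos; [lra | left; apply LM_pos].
Qed.

Lemma ex_extended_profile (Z lam : R) : 0 < lam <= Z -> Ecal d b Z < 1 ->
  exists f, is_extended_profile d lam f.
Proof.
  intros Hlam HE.
  (* Clamping the argument makes uniform distances on the line the same as on [[0, lam]], where the
     contraction estimate holds. *)
  destruct (contraction_fixed_point
    (fun f x => Phi d f (clamp lam x) / Phi d f lam) (Ecal d b Z)) as (f & Cf & Hf).
  - split; [apply Ecal_nonneg; lra | exact HE].
  - intros f Cf x. apply (continuous_mult (K := R_AbsRing) (fun x => Phi d f (clamp lam x)));
      [| apply continuous_const].
    apply (continuous_comp (clamp lam) (Phi d f)); [apply continuous_clamp | now apply continuous_Phi].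
  - intros f g delta Cf Cg Hfg x.
    apply (Phi_ratio_diff_le f g Cf Cg Z lam delta); try lra.
    + apply Rle_trans with (2 := Hfg 0). apply Rabs_pos.
    + intros y _; apply Hfg.
    + apply clamp_in; lra.
  - intros x. rewrite Rabs_right.
    + apply Phi_ratio_bounds; try lra; [intros; apply continuous_const | apply clamp_in; lra].
    + apply Rle_ge, Phi_ratio_bounds; try lra; [intros; apply continuous_const | apply clamp_in; lra].
  - exists f. split; [exact Cf |]. intros x. now rewrite Hf.
Qed.

Lemma Phi_increment_le (f : R -> R) (Z z w : R) : (forall x, continuous f x) ->
  0 <= z <= w -> w <= Z ->
  0 <= Phi d f w - Phi d f z <= exp (2 * Z * (muM / Lm)) / Lm * (w - z).
Proof.
  intros Cf Hzw HwZ. assert (HLm := Lm_pos).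
  split; [assert (H := Phi_le f Cf z w Hzw); lra |].
  destruct (MVT_gen (Phi d f) z w (fun z => Efun d f z / Lstar d f z)) as (c & Hc1 & Hc2).
  - intros; now apply is_derive_Phi.
  - intros. now apply continuity_pt_filterlim, continuous_Phi.
  - rewrite Rmin_left, Rmax_right in Hc1 by lra.
    rewrite Hc2. apply Rmult_le_compat_r; [lra |].
    assert (H := Efun_le_uniform Z f c Cf ltac:(lra)).
    rewrite Rabs_right in H by (apply Rle_ge; left; apply Efun_pos).
    apply Rmult_le_compat; trivial.
    + left; apply Efun_pos.
    + left; apply Rinv_0_lt_compat, Lstar_pos.
    + apply Rinv_le_contravar; [lra | apply nb].
Qed.

Lemma Efun_increment_le (f : R -> R) (Z z w : R) : (forall x, continuous f x) ->
  0 <= z <= w -> w <= Z ->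
  Rabs (Efun d f z - Efun d f w)
    <= exp (2 * Z * (muM / Lm)) * (2 * (muM / Lm) + 2 * (Z * (NM / Lm))) * (w - z).
Proof.
  intros Cf Hzw HwZ. assert (HLm := Lm_pos). assert (HNM := NM_pos).
  destruct (MVT_gen (Efun d f) z w (fun z => Efun d f z *
    (2 * (mustar d f z / Lstar d f z) - 2 * (z * Nstar d f z / Lstar d f z)))) as (c & Hc1 & Hc2).
  - intros; now apply is_derive_Efun.
  - intros. now apply continuity_pt_filterlim, continuous_Efun.
  - rewrite Rmin_left, Rmax_right in Hc1 by lra.
    rewrite Rabs_minus_sym, Hc2, Rabs_mult, (Rabs_right (w - z)) by lra.
    apply Rmult_le_compat_r; [lra |].
    rewrite Rabs_mult. apply Rmult_le_compat; try apply Rabs_pos.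
    + apply Efun_le_uniform; trivial; lra.
    + assert (H1 := U_integrand_bounds f c). assert (H2 := I_integrand_bounds f c ltac:(lra)).
      assert (H3 : 0 <= c * (Nm / LM)).
      { apply Rmult_le_pos; [lra |]. apply Rdiv_le_0_compat; [left; apply Nm_pos | apply LM_pos]. }
      assert (H4 : c * (NM / Lm) <= Z * (NM / Lm)).
      { apply Rmult_le_compat_r; [apply Rdiv_le_0_compat |]; lra. }
      apply Rabs_le. lra.
Qed.

Section Stability.

Context (Z : R) (HE : Ecal d b Z < 1).

(** The defect of [f] as a fixed point for [lam'], divided by [1 - Ecal]. For [lam = lam'] the bound
    is 0, so the same statement also yields uniqueness. *)
Lemma extended_profile_dist (lam lam' : R) (f f' : R -> R) :
  0 < lam <= lam' -> lam' <= Z ->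
  is_extended_profile d lam f -> is_extended_profile d lam' f' ->
  forall x, 0 <= x <= lam' ->
    Rabs (f x - f' x) <=
    exp (2 * Z * (muM / Lm)) / Lm * (lam' - lam)
      / (lam * (exp (- (Z ^ 2 * (NM / Lm))) / LM)) / (1 - Ecal d b Z).
Proof.
  intros Hlam HlamZ [Cf Hf] [Cf' Hf'].
  assert (Hm : 0 < exp (- (Z ^ 2 * (NM / Lm))) / LM) by (apply Rdiv_lt_0_compat; [apply exp_pos | apply LM_pos]).
  assert (HPhi := Phi_ge f Cf Z lam' ltac:(lra)).
  set (m := exp (- (Z ^ 2 * (NM / Lm))) / LM) in *.
  assert (HM : 0 < exp (2 * Z * (muM / Lm)) / Lm) by (apply Rdiv_lt_0_compat; [apply exp_pos | apply Lm_pos]).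
  assert (HPhiP := Phi_pos f Cf lam' ltac:(lra)).
  assert (HPhiP0 := Phi_pos f Cf lam ltac:(lra)).
  assert (Hlm : 0 < lam * m) by (apply Rmult_lt_0_compat; lra).
  set (c := exp (2 * Z * (muM / Lm)) / Lm * (lam' - lam) / (lam * m)).
  assert (Hc0 : 0 <= c).
  { apply Rdiv_le_0_compat; trivial. apply Rmult_le_pos; lra. }
  assert (Hc : forall x, 0 <= x <= lam' -> Rabs (f x - Phi d f x / Phi d f lam') <= c).
  { intros x Hx.
    (* On [[0, lam]] the defect is [f x], a number in [[0, 1]], times this ratio; beyond [lam],
       where [f] is 1, monotonicity of [Phi] gives the same bound. *)
    apply Rle_trans with ((Phi d f lam' - Phi d f lam) / Phi d f lam').
    - rewrite (Hf x). destruct (Rle_dec x lam) as [Hxl | Hxl].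
      + rewrite clamp_id by lra.
        assert (Hr := Phi_ratio_bounds f lam x Cf ltac:(lra) ltac:(lra)).
        assert (Hi := Phi_increment_le f Z lam lam' Cf ltac:(lra) HlamZ).
        replace (Phi d f x / Phi d f lam - Phi d f x / Phi d f lam')
          with (Phi d f x / Phi d f lam * ((Phi d f lam' - Phi d f lam) / Phi d f lam')) by (field; lra).
        assert (0 <= (Phi d f lam' - Phi d f lam) / Phi d f lam') by (apply Rdiv_le_0_compat; lra).
        rewrite Rabs_right by nra. nra.
      + rewrite clamp_above by lra.
        assert (Hi := Phi_increment_le f Z x lam' Cf ltac:(lra) HlamZ).
        assert (Hi2 := Phi_increment_le f Z lam x Cf ltac:(lra) ltac:(lra)).
        replace (Phi d f lam / Phi d f lam - Phi d f x / Phi d f lam')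
          with ((Phi d f lam' - Phi d f x) / Phi d f lam') by (field; lra).
        rewrite Rabs_right by (apply Rle_ge, Rdiv_le_0_compat; lra).
        apply Rdiv_le_compat; lra.
    - assert (Hi := Phi_increment_le f Z lam lam' Cf ltac:(lra) HlamZ).
      apply Rmult_le_compat; try lra.
      + left; now apply Rinv_0_lt_compat.
      + apply Rinv_le_contravar; trivial. apply Rle_trans with (2 := HPhi).
        apply Rmult_le_compat_r; lra. }
  intros x Hx.
  apply (le_of_affine_self_bound (fun x => 0 <= x <= lam') (fun x => Rabs (f x - f' x))); trivial.
  - split; [apply Ecal_nonneg; lra | exact HE].
  - intros y Hy. rewrite Hf, Hf'.
    assert (H1 := Phi_ratio_bounds f lam _ Cf ltac:(lra) (clamp_in lam y ltac:(lra))).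
    assert (H2 := Phi_ratio_bounds f' lam' _ Cf' ltac:(lra) (clamp_in lam' y ltac:(lra))).
    apply Rabs_le. lra.
  - intros delta Hdelta Hfg y Hy.
    replace (f y - f' y) with ((f y - Phi d f y / Phi d f lam')
      + (Phi d f y / Phi d f lam' - Phi d f' y / Phi d f' lam')).
    + apply Rle_trans with (1 := Rabs_triang _ _). apply Rplus_le_compat; auto.
      apply (Phi_ratio_diff_le f f' Cf Cf' Z lam' delta); trivial. lra.
    + rewrite (Hf' y) at 1. rewrite clamp_id by lra. ring.
Qed.

Lemma is_unique_profile_profile (lam : R) : 0 < lam <= Z -> is_unique_profile d lam (profile d lam).
Proof.
  intros Hlam.
  assert (Hp : is_profile d lam (profile d lam)).
  { apply (epsilon_spec (inhabits (fun _ : R => 0)) (is_profile d lam)).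
    destruct (ex_extended_profile Z lam Hlam HE) as [f Hf].
    exists f. now apply profile_of_extended_profile. }
  split; [exact Hp |]. intros g Hg x Hx.
  assert (H := extended_profile_dist lam lam _ _ ltac:(lra) (proj2 Hlam)
    (extended_profile_of_profile d lam _ (proj1 Hlam) Hg)
    (extended_profile_of_profile d lam _ (proj1 Hlam) Hp) x Hx).
  cbv beta in H. rewrite clamp_id, Rminus_diag, Rmult_0_r in H by trivial.
  unfold Rdiv in H. rewrite !Rmult_0_l in H.
  apply Rminus_diag_uniq, Rabs_eq_0. apply Rle_antisym; [exact H | apply Rabs_pos].
Qed.

(** The choice made in [profile] leaves the values outside [[0, lam]] undetermined; clamping
    replaces them by the boundary values. *)
Definition extended_profile (lam x : R) : R := profile d lam (clamp lam x).

Lemma is_extended_profile_extended_profile (lam : R) : 0 < lam <= Z ->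
  is_extended_profile d lam (extended_profile lam).
Proof.
  intros Hlam. apply extended_profile_of_profile; [lra |].
  now apply is_unique_profile_profile.
Qed.

Lemma Vcal_extended_profile (lam : R) : 0 < lam ->
  Vcal d lam = Ste d / 2 * (Efun d (extended_profile lam) lam / Phi d (extended_profile lam) lam).
Proof.
  intros Hlam. unfold Vcal.
  assert (Heq : forall x, 0 <= x <= lam -> profile d lam x = extended_profile lam x).
  { intros x Hx. unfold extended_profile. now rewrite clamp_id. }
  now rewrite (Efun_ext d _ _ lam (Rlt_le _ _ Hlam) Heq), (Phi_ext d _ _ lam (Rlt_le _ _ Hlam) Heq).
Qed.

(** The parameter enters [E] and [Phi] twice, as end point and through the profile; each difference
    is split into moving the end point with the profile fixed and then changing the profile. The
    lower bound [lam0] keeps [Phi] away from 0. *)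
Lemma Vcal_lipschitz (lam0 : R) : 0 < lam0 ->
  exists K, forall lam lam', lam0 <= lam <= lam' -> lam' <= Z ->
    Rabs (Vcal d lam - Vcal d lam') <= K * (lam' - lam).
Proof.
  intros Hlam0. assert (HLm := Lm_pos).
  set (X := exp (2 * Z * (muM / Lm))).
  set (m := exp (- (Z ^ 2 * (NM / Lm))) / LM).
  assert (HX : 0 < X) by apply exp_pos.
  assert (Hm : 0 < m) by (apply Rdiv_lt_0_compat; [apply exp_pos | apply LM_pos]).
  assert (Hm0 : 0 < lam0 * m) by now apply Rmult_lt_0_compat.
  (* Lipschitz constants in [lam]: [Kd] of the profile, [KP] of [Phi] and [KE] of [E], both taken at
     the end point. [X] bounds [E] above and [lam0 * m] bounds [Phi] below. *)
  set (Kd := X / Lm / (lam0 * m) / (1 - Ecal d b Z)).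
  set (KP := X / Lm + Z * (D4 d b Z * Kd)).
  set (KE := X * (2 * (muM / Lm) + 2 * (Z * (NM / Lm))) + D3 d b Z * Kd).
  exists (Rabs (Ste d / 2) * ((X * KP + lam0 * m * KE) / (lam0 * m) ^ 2)).
  intros lam lam' Hlam HlamZ.
  rewrite !Vcal_extended_profile by lra.
  assert (Hf := is_extended_profile_extended_profile lam ltac:(lra)).
  assert (Hf' := is_extended_profile_extended_profile lam' ltac:(lra)).
  assert (Hdist := extended_profile_dist lam lam' _ _ ltac:(lra) HlamZ Hf Hf').
  destruct Hf as [Cf _], Hf' as [Cf' _].
  set (f := extended_profile lam) in *. set (f' := extended_profile lam') in *.
  set (delta := Kd * (lam' - lam)).
  assert (Hdelta : 0 <= delta).
  { apply Rmult_le_pos; [| lra]. repeat apply Rdiv_le_0_compat; lra. }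
  assert (Hff' : forall x, 0 <= x <= lam' -> Rabs (f x - f' x) <= delta).
  { intros x Hx. apply Rle_trans with (1 := Hdist x Hx). fold X m. unfold delta, Kd.
    replace (X / Lm / (lam0 * m) / (1 - Ecal d b Z) * (lam' - lam))
      with (X / Lm * (lam' - lam) / (lam0 * m) / (1 - Ecal d b Z)) by (field; lra).
    apply Rdiv_le_compat; [lra |]. apply Rmult_le_compat_l.
    - apply Rmult_le_pos; [left; now apply Rdiv_lt_0_compat | lra].
    - apply Rinv_le_contravar; trivial. apply Rmult_le_compat_r; lra. }
  assert (HdP : Rabs (Phi d f lam - Phi d f' lam') <= KP * (lam' - lam)).
  { replace (Phi d f lam - Phi d f' lam')
      with ((Phi d f lam - Phi d f lam') + (Phi d f lam' - Phi d f' lam')) by ring.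
    apply Rle_trans with (1 := Rabs_triang _ _).
    unfold KP. rewrite Rmult_plus_distr_r. apply Rplus_le_compat.
    - assert (H := Phi_increment_le f Z lam lam' Cf ltac:(lra) HlamZ). fold X in H.
      apply Rabs_le. lra.
    - assert (H := Phi_diff_le f f' Cf Cf' Z lam' delta HlamZ Hdelta Hff' lam' ltac:(lra)).
      assert (H0 := Phi_integrand_diff_le f f' Cf Cf' Z lam' delta HlamZ Hdelta Hff' lam' ltac:(lra)).
      apply Rle_trans with (1 := H).
      replace (Z * (D4 d b Z * Kd) * (lam' - lam)) with (Z * (D4 d b Z * delta)) by (unfold delta; ring).
      apply Rmult_le_compat_r; trivial. apply Rle_trans with (2 := H0). apply Rabs_pos. }
  assert (HdE : Rabs (Efun d f lam - Efun d f' lam') <= KE * (lam' - lam)).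
  { replace (Efun d f lam - Efun d f' lam')
      with ((Efun d f lam - Efun d f lam') + (Efun d f lam' - Efun d f' lam')) by ring.
    apply Rle_trans with (1 := Rabs_triang _ _).
    unfold KE. rewrite Rmult_plus_distr_r. apply Rplus_le_compat.
    - now apply Efun_increment_le; try lra.
    - rewrite Rmult_assoc.
      apply (Efun_diff_le f f' Cf Cf' Z lam' delta HlamZ Hdelta Hff'). lra. }
  rewrite <- Rmult_minus_distr_l, Rabs_mult, Rmult_assoc.
  apply Rmult_le_compat_l; [apply Rabs_pos |].
  assert (HP : forall h z, (forall x, continuous h x) -> lam0 <= z <= Z -> lam0 * m <= Phi d h z).
  { intros h z Ch Hz. apply Rle_trans with (2 := Phi_ge h Ch Z z ltac:(lra)).
    fold m. apply Rmult_le_compat_r; lra. }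
  apply Rle_trans with (1 := abs_div_diff_le _ _ _ _ _ _ Hm0
    (HP f lam Cf ltac:(lra)) (HP f' lam' Cf' ltac:(lra)) (Efun_le_uniform Z f lam Cf ltac:(lra))).
  fold X.
  replace ((X * KP + lam0 * m * KE) / (lam0 * m) ^ 2 * (lam' - lam))
    with ((X * (KP * (lam' - lam)) + lam0 * m * (KE * (lam' - lam))) / (lam0 * m) ^ 2) by (field; lra).
  apply Rdiv_le_compat; [now apply pow_lt |].
  apply Rplus_le_compat; apply Rmult_le_compat_l; lra.
Qed.

End Stability.

(** * The free boundary coefficient *)

(** Integrating the exponential bound on [E] gives [2 * muM * Phi <= X - 1]; strictness comes from
    dropping the [- 1]. *)
Lemma V1_lt (f : R -> R) (lam : R) : (forall x, continuous f x) -> 0 < Ste d -> 0 < lam ->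
  V1 d b lam < Ste d / 2 * (Efun d f lam / Phi d f lam).
Proof.
  intros Cf HSte Hlam. assert (HLm := Lm_pos). assert (Hmu := muM_pos). assert (HNM := NM_pos).
  assert (HP := Phi_pos f Cf lam Hlam).
  set (X := exp (2 * lam * (muM / Lm))).
  assert (HX : 0 < X) by apply exp_pos.
  assert (HPhi : Phi d f lam <= (X - 1) / (2 * muM)).
  { replace ((X - 1) / (2 * muM)) with (X / (2 * muM) - exp (2 * 0 * (muM / Lm)) / (2 * muM))
      by (rewrite Rmult_0_r, Rmult_0_l, exp_0; field; lra).
    unfold X.
    apply (RInt_le_antiderivative _ (fun y => exp (2 * y * (muM / Lm)) / (2 * muM))
             (fun y => exp (2 * y * (muM / Lm)) / Lm)).
    - lra.
    - now apply continuous_Phi_integrand.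
    - intros x. apply (ex_derive_continuous (V := R_NormedModule)). auto_derive. lra.
    - intros x. auto_derive; [lra |]. field. lra.
    - intros x Hx. apply Rmult_le_compat.
      + left; apply Efun_pos.
      + left; apply Rinv_0_lt_compat, Lstar_pos.
      + apply Efun_le; [trivial | lra].
      + apply Rinv_le_contravar; [lra | apply nb]. }
  (* The exponent given by [Efun_ge] is doubled to match the one in [V1]. *)
  assert (HY : exp (- (2 * lam ^ 2 * (NM / Lm))) <= Efun d f lam).
  { apply Rle_trans with (2 := Efun_ge f Cf lam ltac:(lra)). apply exp_le.
    assert (0 <= lam ^ 2 * (NM / Lm)); [| lra].
    apply Rmult_le_pos; [apply pow2_ge_0 | apply Rdiv_le_0_compat; lra]. }
  unfold V1.
  replace (exp (-2 * lam * (muM / Lm) - 2 * lam ^ 2 * (NM / Lm)))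
    with (exp (- (2 * lam ^ 2 * (NM / Lm))) / X).
  2:{ unfold X, Rdiv. rewrite <- exp_Ropp, <- exp_plus. f_equal. ring. }
  set (Y := exp (- (2 * lam ^ 2 * (NM / Lm)))) in *.
  assert (HY0 : 0 < Y) by apply exp_pos.
  assert (HPhi' : Phi d f lam * (2 * muM) <= X - 1) by (apply Rle_div_r in HPhi; lra).
  apply Rlt_0_minus.
  replace (Ste d / 2 * (Efun d f lam / Phi d f lam) - Ste d * muM * (Y / X))
    with (Ste d / 2 * ((Efun d f lam * X - 2 * muM * Phi d f lam * Y) / (Phi d f lam * X)))
    by (field; lra).
  apply Rmult_lt_0_compat; [lra |].
  apply Rdiv_lt_0_compat; [nra | now apply Rmult_lt_0_compat].
Qed.

(** The error function arises from the Gaussian lower bound [1 / I] for [E]. Strictness comes from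
    [U > 1] at positive arguments, which makes [LM * Phi] exceed the Gaussian integral [J]. *)
Lemma lt_V2 (f : R -> R) (lam : R) : (forall x, continuous f x) -> 0 < Ste d -> 0 < lam ->
  Ste d / 2 * (Efun d f lam / Phi d f lam) < V2 d b lam.
Proof.
  intros Cf HSte Hlam. assert (HLm := Lm_pos). assert (HLM := LM_pos). assert (HNM := NM_pos).
  assert (HP := Phi_pos f Cf lam Hlam).
  set (r := NM / Lm).
  assert (Hr : 0 < r) by now apply Rdiv_lt_0_compat.
  set (J := RInt (fun y => exp (- (y ^ 2 * r))) 0 lam).
  assert (CJ : forall x, continuous (fun y => exp (- (y ^ 2 * r))) x).
  { intros x. apply (ex_derive_continuous (V := R_NormedModule)). auto_derive. trivial. }
  assert (HJ : 0 < J) by (apply RInt_gt_0; trivial; intros; apply exp_pos).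
  assert (HJPhi : J < LM * Phi d f lam).
  { assert (CPhi := continuous_Phi_integrand f Cf).
    replace (LM * Phi d f lam) with (RInt (fun y => LM * (Efun d f y / Lstar d f y)) 0 lam)
      by now apply (RInt_scal (V := R_CompleteNormedModule)), ex_RInt_continuous_global.
    apply RInt_lt; trivial.
    - intros x _. apply (continuous_scal_r (V := R_NormedModule)), CPhi.
    - intros x Hx. assert (HU := Ufun_gt_1 f Cf x (proj1 Hx)).
      assert (HI := Ifun_bounds f Cf x ltac:(lra)). fold r in HI.
      assert (HI0 : 0 < Ifun d f x) by apply exp_pos.
      assert (HL := nb_L d b nb f x). assert (HL0 := Lstar_pos f x).
      apply Rlt_le_trans with (Efun d f x).
      + rewrite exp_Ropp. apply Rle_lt_trans with (/ Ifun d f x).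
        * apply Rinv_le_contravar; lra.
        * unfold Efun. rewrite <- (Rmult_1_l (/ Ifun d f x)) at 1.
          apply Rmult_lt_compat_r; [now apply Rinv_0_lt_compat | exact HU].
      + replace (LM * (Efun d f x / Lstar d f x)) with (Efun d f x * LM / Lstar d f x) by (field; lra).
        apply (proj1 (Rle_div_r _ _ _ HL0)). apply Rmult_le_compat_l; [left; apply Efun_pos | lra]. }
  assert (HPI : 0 < sqrt PI) by apply sqrt_lt_R0, PI_RGT_0.
  assert (Ha : 0 < sqrt r) by now apply sqrt_lt_R0.
  assert (Herf : erf (sqrt r * lam) = 2 / sqrt PI * (sqrt r * J)).
  (* Substitution [u = sqrt r * y]. *)
  { unfold erf. f_equal.
    assert (Hint : forall u v : R, ex_RInt (fun u => exp (- u ^ 2)) u v).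
    { intros u v. apply ex_RInt_continuous_global. intros x.
      apply (ex_derive_continuous (V := R_NormedModule)). auto_derive. trivial. }
    assert (Hsub := RInt_comp_lin (fun u => exp (- u ^ 2)) (sqrt r) 0 0 lam (Hint _ _)).
    rewrite Rmult_0_r, !Rplus_0_r in Hsub. rewrite <- Hsub.
    transitivity (RInt (fun y => sqrt r * exp (- (y ^ 2 * r))) 0 lam).
    - apply RInt_ext. intros x _.
      change (sqrt r * exp (- (sqrt r * x + 0) ^ 2) = sqrt r * exp (- (x ^ 2 * r))).
      do 3 f_equal. rewrite Rplus_0_r, Rpow_mult_distr, pow2_sqrt; lra.
    - now apply (RInt_scal (V := R_CompleteNormedModule)), ex_RInt_continuous_global. }
  set (W := exp (2 * lam * (muM / Lm)) / exp (lam ^ 2 * (Nm / LM))).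
  assert (HEW : Efun d f lam <= W).
  { assert (HU := Ufun_bounds f Cf lam ltac:(lra)). assert (HI := Ifun_bounds f Cf lam ltac:(lra)).
    apply Rmult_le_compat; try lra.
    - left; apply Rinv_0_lt_compat, exp_pos.
    - apply Rinv_le_contravar; [apply exp_pos | lra]. }
  assert (HE0 := Efun_pos f lam).
  assert (HV2 : V2 d b lam = Ste d / 2 * (LM * W / J)).
  { unfold V2. fold r. rewrite Herf, <- sqrt_div by lra. fold r.
    replace (exp (2 * lam * muM / Lm - lam ^ 2 * Nm / LM)) with W.
    - field. lra.
    - unfold W, Rdiv. rewrite <- exp_Ropp, <- exp_plus. f_equal. field. lra. }
  rewrite HV2. apply Rmult_lt_compat_l; [lra |]. apply Rlt_0_minus.
  replace (LM * W / J - Efun d f lam / Phi d f lam)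
    with ((LM * Phi d f lam * W - J * Efun d f lam) / (J * Phi d f lam)) by (field; lra).
  apply Rdiv_lt_0_compat; [nra | now apply Rmult_lt_0_compat].
Qed.

Lemma Vcal_fixed_point (lam1 lam2 : R) : 0 < Ste d -> 0 < lam1 < lam2 -> Ecal d b lam2 < 1 ->
  V1 d b lam1 = lam1 -> V2 d b lam2 = lam2 ->
  exists lam, lam1 < lam < lam2 /\ Vcal d lam = lam.
Proof.
  intros HSte Hlam HE HV1 HV2.
  destruct (Vcal_lipschitz lam2 HE lam1 (proj1 Hlam)) as [K HK].
  assert (HV : forall lam, lam1 <= lam <= lam2 -> V1 d b lam < Vcal d lam < V2 d b lam).
  { intros lam Hl. rewrite Vcal_extended_profile by lra.
    destruct (is_extended_profile_extended_profile lam2 HE lam ltac:(lra)) as [Cf _].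
    split; [apply V1_lt | apply lt_V2]; trivial; lra. }
  (* The intermediate value theorem is applied to a function continuous on the whole line, whereas
     [Vcal] is controlled only on [[lam1, lam2]]; [c] retracts onto that interval. *)
  pose (c := fun x => lam1 + clamp (lam2 - lam1) (x - lam1)).
  assert (Hc : forall x, lam1 <= c x <= lam2).
  { intros x. assert (H := clamp_in (lam2 - lam1) (x - lam1) ltac:(lra)). unfold c. lra. }
  assert (Hid : forall x, lam1 <= x <= lam2 -> c x = x).
  { intros x Hx. unfold c. rewrite clamp_id; lra. }
  assert (Hclip : forall x y, Rabs (c y - c x) <= Rabs (y - x)).
  { intros x y. unfold c. assert (H := clamp_lipschitz (lam2 - lam1) (x - lam1) (y - lam1)).
    replace (lam1 + clamp (lam2 - lam1) (y - lam1) - (lam1 + clamp (lam2 - lam1) (x - lam1)))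
      with (clamp (lam2 - lam1) (y - lam1) - clamp (lam2 - lam1) (x - lam1)) by ring.
    replace (y - x) with (y - lam1 - (x - lam1)) by ring. lra. }
  assert (HKabs : forall x y, lam1 <= x <= lam2 -> lam1 <= y <= lam2 ->
    Rabs (Vcal d x - Vcal d y) <= Rabs K * Rabs (x - y)).
  { assert (H : forall x y, lam1 <= x <= y -> y <= lam2 ->
      Rabs (Vcal d x - Vcal d y) <= Rabs K * Rabs (x - y)).
    { intros x y Hxy Hy. apply Rle_trans with (1 := HK x y Hxy Hy).
      rewrite (Rabs_minus_sym x), (Rabs_right (y - x)) by lra.
      apply Rmult_le_compat_r; [lra | apply Rle_abs]. }
    intros x y Hx Hy. destruct (Rle_dec x y).
    - apply H; lra.
    - rewrite Rabs_minus_sym, (Rabs_minus_sym x). apply H; lra. }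
  destruct (IVT (fun x => c x - Vcal d (c x)) lam1 lam2) as (z & Hz & Hz0).
  - intros x. apply continuity_pt_filterlim.
    apply (lipschitz_continuous (fun x => c x - Vcal d (c x)) (1 + Rabs K)). clear x. intros x y.
    replace (c y - Vcal d (c y) - (c x - Vcal d (c x)))
      with (c y - c x + (Vcal d (c x) - Vcal d (c y))) by ring.
    apply Rle_trans with (1 := Rabs_triang _ _).
    assert (H1 := HKabs (c x) (c y) (Hc x) (Hc y)). rewrite (Rabs_minus_sym (c x)) in H1.
    assert (H2 := Hclip x y). assert (H3 := Rabs_pos K). nra.
  - lra.
  - rewrite Hid by lra. assert (H := HV lam1 ltac:(lra)). lra.
  - rewrite Hid by lra. assert (H := HV lam2 ltac:(lra)). lra.
  (* The zero lies in the closed interval; the strict inequalities in [HV] exclude both ends. *)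
  - rewrite Hid in Hz0 by lra. exists z. split; [| lra].
    split; apply Rnot_le_lt; intros Hle.
    + assert (z = lam1) as -> by lra. assert (H := HV lam1 ltac:(lra)). lra.
    + assert (z = lam2) as -> by lra. assert (H := HV lam2 ltac:(lra)). lra.
Qed.

(** * The similarity solution *)

Lemma heat_equation_of_derivatives (T : R -> R -> R) (x t Tt Tx flux_x : R) :
  is_derive (fun tau => T x tau) t Tt ->
  is_derive (fun y => T y t) x Tx ->
  is_derive (fun y => coef_k d (T y t) * Derive (fun z => T z t) y) x flux_x ->
  coef_rho d (T x t) * coef_c d (T x t) * Tt = flux_x - velocity d (T x t) t * Tx ->
  heat_equation d T x t.
Proof.
  intros Ht Hx Hflux Heq. unfold heat_equation. cbv zeta.
  assert (Dt : Derive (fun tau : R => T x tau) t = Tt) by exact (is_derive_unique _ _ _ Ht).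
  assert (Dx : Derive (fun y : R => T y t) x = Tx) by exact (is_derive_unique _ _ _ Hx).
  assert (Dflux : Derive (fun y : R => coef_k d (T y t) * Derive (fun z : R => T z t) y) x = flux_x)
    by exact (is_derive_unique _ _ _ Hflux).
  split; [now eexists; exact Ht |]. split; [now eexists; exact Hx |].
  split; [now eexists; exact Hflux |]. now rewrite Dt, Dx, Dflux.
Qed.

(** At the free boundary the extended profile has a corner, being constant beyond [lam]. The
    one-sided derivative is taken from a function [G] differentiable across the boundary that agrees
    with [g] on the left. *)
Lemma is_left_derive_of_is_derive (g G : R -> R) (a l : R) :
  is_derive G a l -> at_left a (fun y => g y = G y) -> g a = G a -> is_left_derive g a l.
Proof.
  intros HG HgG Ha. unfold is_left_derive. rewrite Ha.
  apply (filterlim_ext_loc (fun y => (G y - G a) / (y - a))).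
  { apply filter_imp with (2 := HgG). intros y ->. reflexivity. }
  apply filterlim_locally. intros eps.
  apply is_derive_Reals in HG. destruct (HG eps (cond_pos eps)) as [delta Hdelta].
  exists delta. intros y Hy Hya. change (Rabs (y - a) < delta) in Hy.
  change (Rabs ((G y - G a) / (y - a) - l) < eps).
  assert (H := Hdelta (y - a) ltac:(lra) Hy).
  rewrite Rplus_minus in H. exact H.
Qed.

Section Similarity.

Context (lam : R) (f : R -> R) (Hlam : 0 < lam) (Hf : is_extended_profile d lam f).

Lemma is_derive_extended_profile (xi : R) : 0 < xi < lam ->
  is_derive f xi (Efun d f xi / Lstar d f xi / Phi d f lam).
Proof.
  intros Hxi. destruct Hf as [Cf Hfix].
  apply (is_derive_ext_loc (fun z => Phi d f z * / Phi d f lam)).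
  - apply (filter_imp (fun y => 0 < y /\ y < lam)).
    + intros y Hy. rewrite (Hfix y), clamp_id by lra. reflexivity.
    + apply (open_and _ _ (open_gt 0) (open_lt lam)). exact Hxi.
  - apply (is_derive_scal_l (V := R_NormedModule) (Phi d f)). now apply is_derive_Phi.
Qed.

Lemma similarity_solution : data_admissible d ->
  Ste d / 2 * (Efun d f lam / Phi d f lam) = lam ->
  is_stefan_solution d
    (fun x t => (Tmelt d - Tstar d) * f (x / (2 * sqrt (alpha0 d * t))) + Tstar d)
    (fun t => 2 * lam * sqrt (alpha0 d * t)).
Proof.
  intros (HT & Hrho & Hc & Hk & Hell) HV.
  assert (Hext := is_derive_extended_profile).
  destruct Hf as [Cf Hfix].
  assert (HP := Phi_pos f Cf lam Hlam).
  assert (Halpha : 0 < alpha0 d).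
  { apply Rdiv_lt_0_compat; trivial. now apply Rmult_lt_0_compat. }
  set (kap := Tmelt d - Tstar d).
  set (sa := sqrt (alpha0 d)).
  assert (Hsa : 0 < sa) by now apply sqrt_lt_R0.
  (* With [k0], [alpha0] and [t] written as products of roots, all final identities become rational
     in [sa] and [sqrt t]. *)
  assert (Hk0 : k0 d = rho0 d * c0 d * (sa * sa)).
  { unfold sa. rewrite sqrt_sqrt by lra. unfold alpha0. field. lra. }
  assert (Hmu0 : sqrt (rho0 d * c0 d * k0 d) = rho0 d * c0 d * sa).
  { rewrite Hk0. replace (rho0 d * c0 d * (rho0 d * c0 d * (sa * sa)))
      with ((rho0 d * c0 d * sa) * (rho0 d * c0 d * sa)) by ring.
    apply sqrt_square. repeat apply Rmult_le_pos; lra. }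
  assert (HA : forall t, 0 < t -> 0 < 2 * sqrt (alpha0 d * t)).
  { intros t Ht. apply Rmult_lt_0_compat; [lra |]. now apply sqrt_lt_R0, Rmult_lt_0_compat. }
  assert (Hsst : forall t, 0 < t -> sqrt (alpha0 d * t) = sa * sqrt t).
  { intros t Ht. apply sqrt_mult; lra. }
  assert (Hf0 : f 0 = 0).
  { rewrite Hfix, clamp_id, Phi_0 by lra. unfold Rdiv. ring. }
  assert (Hflam : f lam = 1).
  { rewrite Hfix, clamp_id by lra. field. lra. }
  assert (Hxi : forall x t, 0 < t -> 0 < x < 2 * lam * sqrt (alpha0 d * t) ->
    0 < x / (2 * sqrt (alpha0 d * t)) < lam).
  { intros x t Ht Hx. assert (H := HA t Ht). split.
    - apply Rdiv_lt_0_compat; lra.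
    - apply Rlt_div_l; lra. }
  assert (Hs : forall t, 0 < t ->
    is_derive (fun t => 2 * lam * sqrt (alpha0 d * t)) t (lam * sa / sqrt t)).
  { intros t Ht. auto_derive.
    - now apply Rmult_lt_0_compat.
    - assert (H := sqrt_lt_R0 t Ht). rewrite Hsst by trivial.
      replace (alpha0 d) with (sa * sa) by (apply sqrt_sqrt; lra). field. lra. }
  assert (HTx : forall y t, 0 < t -> 0 < y < 2 * lam * sqrt (alpha0 d * t) ->
    is_derive (fun z => kap * f (z / (2 * sqrt (alpha0 d * t))) + Tstar d) y
      (kap * (Efun d f (y / (2 * sqrt (alpha0 d * t))) / Lstar d f (y / (2 * sqrt (alpha0 d * t)))
              / Phi d f lam) / (2 * sqrt (alpha0 d * t)))).
  { intros y t Ht Hy. assert (HAt := HA t Ht).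
    assert (Hd := Hext _ (Hxi y t Ht Hy)).
    set (a := 2 * sqrt (alpha0 d * t)) in *. set (e := _ / Phi d f lam) in Hd |- *.
    auto_derive; [now eexists; exact Hd |].
    assert (DF : Derive (fun x : R => f x) (y * / a) = e) by exact (is_derive_unique _ _ _ Hd).
    rewrite DF. field. lra. }
  split; [| split; [| split; [| split; [| split; [| split; [| split]]]]]].
  (* [sqrt] is 0 on negative numbers, hence continuous everywhere, including at [t = 0]. *)
  - apply continuous_on_forall. intros t _.
    apply (continuous_scal_r (V := R_NormedModule) (2 * lam) (fun t => sqrt (alpha0 d * t))).
    apply continuous_sqrt_comp, (continuous_scal_r (V := R_NormedModule) (alpha0 d) (fun t => t)), continuous_id.
  - intros t Ht. split.
    + assert (H := HA t Ht). nra.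
    + eexists. now apply Hs.
  - apply continuous_on_forall. intros [x t] [Ht _]. simpl in Ht.
    apply (continuous_plus (V := R_NormedModule) (fun p : R * R => kap * f (fst p / (2 * sqrt (alpha0 d * snd p)))));
      [| apply continuous_const].
    apply (continuous_scal_r (V := R_NormedModule) kap (fun p : R * R => f (fst p / (2 * sqrt (alpha0 d * snd p))))).
    apply (continuous_comp (fun p : R * R => fst p / (2 * sqrt (alpha0 d * snd p))) f); [| apply Cf].
    apply (continuous_mult (K := R_AbsRing) (fun p : R * R => fst p)); [apply continuous_fst |].
    apply (continuous_comp (fun p : R * R => snd p) (fun t => / (2 * sqrt (alpha0 d * t))));
      [apply continuous_snd |].
    apply continuous_Rinv_comp; [| apply Rgt_not_eq, HA, Ht].
    apply (continuous_scal_r (V := R_NormedModule) 2 (fun t => sqrt (alpha0 d * t))).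
    apply continuous_sqrt_comp, (continuous_scal_r (V := R_NormedModule) (alpha0 d) (fun t => t)), continuous_id.
  - intros x t Ht Hx. assert (HAt := HA t Ht). assert (Hst := sqrt_lt_R0 t Ht).
    assert (Htt : t = sqrt t * sqrt t) by (rewrite sqrt_sqrt; lra).
    assert (Hd := Hext _ (Hxi x t Ht Hx)).
    (* [k(T)] is [k0 * Lstar] and cancels the denominator in [T_x], so near [x] the flux is a
       constant times [E] of the similarity variable. *)
    assert (Hflux : is_derive (fun y => coef_k d (kap * f (y / (2 * sqrt (alpha0 d * t))) + Tstar d) *
        Derive (fun z => kap * f (z / (2 * sqrt (alpha0 d * t))) + Tstar d) y) x
      (k0 d * kap / (Phi d f lam * (2 * sqrt (alpha0 d * t))) *
       (Efun d f (x / (2 * sqrt (alpha0 d * t))) *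
        (2 * (mustar d f (x / (2 * sqrt (alpha0 d * t))) / Lstar d f (x / (2 * sqrt (alpha0 d * t))))
         - 2 * (x / (2 * sqrt (alpha0 d * t)) * Nstar d f (x / (2 * sqrt (alpha0 d * t)))
                / Lstar d f (x / (2 * sqrt (alpha0 d * t)))))
        / (2 * sqrt (alpha0 d * t))))).
    { apply (is_derive_ext_loc (fun y => k0 d * kap / (Phi d f lam * (2 * sqrt (alpha0 d * t)))
                * Efun d f (y / (2 * sqrt (alpha0 d * t))))).
      - apply (filter_imp (fun y => 0 < y /\ y < 2 * lam * sqrt (alpha0 d * t))).
        + intros y Hy. lazymatch goal with |- @eq _ ?u ?v => change (@eq R u v) end.
          replace (Derive _ y) with (kap * (Efun d f (y / (2 * sqrt (alpha0 d * t)))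
              / Lstar d f (y / (2 * sqrt (alpha0 d * t))) / Phi d f lam) / (2 * sqrt (alpha0 d * t)))
            by (symmetry; apply is_derive_unique, HTx; trivial).
          replace (coef_k d _) with (k0 d * Lstar d f (y / (2 * sqrt (alpha0 d * t))))
            by (unfold Lstar, temp; fold kap; field; lra).
          assert (HL := Lstar_pos f (y / (2 * sqrt (alpha0 d * t)))). field. lra.
        + apply (open_and _ _ (open_gt 0) (open_lt (2 * lam * sqrt (alpha0 d * t)))). exact Hx.
      - assert (HdE := is_derive_Efun f Cf (x / (2 * sqrt (alpha0 d * t)))).
        set (a := 2 * sqrt (alpha0 d * t)) in *. set (e := Efun d f (x / a) * _) in *.
        set (g := Efun d f) in *. set (q := _ / (Phi d f lam * a)).
        auto_derive; [now eexists; exact HdE |].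
        assert (DE : Derive (fun x : R => g x) (x * / a) = e) by exact (is_derive_unique _ _ _ HdE).
        rewrite DE. field. lra. }
    assert (HTt : is_derive (fun tau => kap * f (x / (2 * sqrt (alpha0 d * tau))) + Tstar d) t
      (kap * (Efun d f (x / (2 * sqrt (alpha0 d * t))) / Lstar d f (x / (2 * sqrt (alpha0 d * t)))
              / Phi d f lam) * (- (x / (2 * sqrt (alpha0 d * t)) / (2 * t))))).
    { set (e := _ / Phi d f lam) in Hd |- *.
      auto_derive.
      - repeat split; first [now eexists; exact Hd | now apply Rmult_lt_0_compat | lra].
      - assert (DF : Derive (fun x : R => f x) (x * / (2 * sqrt (alpha0 d * t))) = e)
          by exact (is_derive_unique _ _ _ Hd).
        rewrite DF, Hsst by trivial.
        replace (alpha0 d) with (sa * sa) by (apply sqrt_sqrt; lra).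
        replace (kap * e * - (x / (2 * (sa * sqrt t)) / (2 * t)))
          with (kap * e * - (x / (2 * (sa * sqrt t)) / (2 * (sqrt t * sqrt t)))) by now rewrite <- Htt.
        field. lra. }
    (* In the derivative of [E], the part from [U] cancels the convection term and the part from [I]
       equals the time derivative term, because the square of [2 * sqrt (alpha0 d * t)] is
       [4 * alpha0 d * t]. *)
    apply (heat_equation_of_derivatives _ x t _ _ _ HTt (HTx x t Ht Hx) Hflux).
    unfold velocity.
    set (xi := x / (2 * sqrt (alpha0 d * t))) in *.
    replace (coef_rho d _ * coef_c d _) with (rho0 d * c0 d * Nstar d f xi)
      by (unfold Nstar, coef_rhoc, temp; fold kap; field; lra).
    replace (coef_mu d _) with (rho0 d * c0 d * sa * mustar d f xi)
      by (unfold mustar, temp; rewrite Hmu0; fold kap; field; lra).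
    assert (HL := Lstar_pos f xi).
    rewrite Hsst, Hk0 by trivial.
    replace (xi / (2 * t)) with (xi / (2 * (sqrt t * sqrt t))) by now rewrite <- Htt.
    field. lra.
  - intros t Ht. unfold Rdiv. rewrite Rmult_0_l, Hf0. ring.
  - intros t Ht. assert (HAt := HA t Ht).
    replace (2 * lam * sqrt (alpha0 d * t) / (2 * sqrt (alpha0 d * t))) with lam by (field; lra).
    rewrite Hflam. unfold kap. ring.
  - intros t Ht. assert (HAt := HA t Ht). assert (Hst := sqrt_lt_R0 t Ht).
    assert (Hend : 2 * lam * sqrt (alpha0 d * t) / (2 * sqrt (alpha0 d * t)) = lam) by (field; lra).
    exists (kap * (Efun d f lam / Lstar d f lam / Phi d f lam) / (2 * sqrt (alpha0 d * t))). split.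
    + apply (is_left_derive_of_is_derive _
        (fun y => kap * (Phi d f (y / (2 * sqrt (alpha0 d * t))) / Phi d f lam) + Tstar d)).
      * assert (HdP := is_derive_Phi f Cf (2 * lam * sqrt (alpha0 d * t) / (2 * sqrt (alpha0 d * t)))).
        rewrite Hend in HdP at 2 3. cbv beta in HdP.
        set (a := 2 * sqrt (alpha0 d * t)) in *. set (p := Phi d f lam) in *.
        set (g := Phi d f) in *. set (e := Efun d f lam / Lstar d f lam) in *.
        set (y0 := 2 * lam * sqrt (alpha0 d * t)) in *.
        auto_derive; [now eexists; exact HdP |].
        assert (DE : Derive (fun x : R => g x) (y0 * / a) = e) by exact (is_derive_unique _ _ _ HdP).
        rewrite DE. field. lra.
      * unfold at_left, within. apply (filter_imp (fun y => 0 < y)).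
        -- intros y Hy Hys. rewrite (Hfix (y / _)), clamp_id; [reflexivity |].
           assert (H := Hxi y t Ht ltac:(lra)). lra.
        -- apply open_gt. nra.
      * rewrite Hend, Hflam. field. lra.
    + assert (Ds : Derive (fun t : R => 2 * lam * sqrt (alpha0 d * t)) t = lam * sa / sqrt t)
        by exact (is_derive_unique _ _ _ (Hs t Ht)).
      rewrite Hend, Ds.
      replace (coef_k d _) with (k0 d * Lstar d f lam)
        by (unfold Lstar, temp; fold kap; field; lra).
      assert (HL := Lstar_pos f lam).
      (* The equation for [lam] solved for [E]; substituting it turns the flux at the boundary into
         [- rho0 * ell] times the speed. *)
      assert (HV' : Efun d f lam = 2 * lam * ell d * Phi d f lam / ((Tstar d - Tmelt d) * c0 d)).
      { rewrite <- HV at 2. unfold Ste. field. lra. }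
      rewrite HV', Hsst, Hk0 by trivial. unfold kap. field. lra.
  - rewrite Rmult_0_r, sqrt_0. ring.
Qed.

End Similarity.

End Estimates.

Theorem theorem2p3 (d : stefan_data) (b : coef_bounds)
  (Hd : data_admissible d) (Hb : bounds_positive b)
  (HK : hyp_K d b) (HR : hyp_R d b) (HV : hyp_V d b)
  (Hsmall : 2 * k_M b * k_lip b * (Tstar d - Tmelt d) / (k_m b) ^ 2 < 1)
  (lam1 lam2 : R)
  (Hlam1_pos : 0 < lam1) (Hlam1 : V1 d b lam1 = lam1)
  (Hlam12 : lam1 < lam2) (Hlam2 : V2 d b lam2 = lam2)
  (HE : Ecal d b lam2 < 1) :
  exists (T : R -> R -> R) (s : R -> R) (lam : R),
    is_stefan_solution d T s /\
    lam1 < lam < lam2 /\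
    Vcal d lam = lam /\
    (forall t : R, 0 < t -> s t = 2 * lam * sqrt (alpha0 d * t)) /\
    is_unique_profile d lam (profile d lam) /\
    (forall x t : R, 0 < t ->
       0 <= x / (2 * sqrt (alpha0 d * t)) <= lam ->
       T x t = (Tmelt d - Tstar d) *
                 profile d lam (x / (2 * sqrt (alpha0 d * t))) + Tstar d).
Proof.
  assert (nb := normalized_bounds_of_hyp d b Hd Hb HK HR HV).
  assert (HSte : 0 < Ste d).
  { destruct Hd as (HT & _ & Hc & _ & Hell). apply Rdiv_lt_0_compat; nra. }
  destruct (Vcal_fixed_point d b nb lam1 lam2 HSte (conj Hlam1_pos Hlam12) HE Hlam1 Hlam2)
    as (lam & Hlam & HVlam).
  (* The extended profile supplies a temperature continuous up to the free boundary; it coincides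
     with [profile] for similarity variables in [[0, lam]]. *)
  exists (fun x t => (Tmelt d - Tstar d)
            * extended_profile d lam (x / (2 * sqrt (alpha0 d * t))) + Tstar d),
    (fun t => 2 * lam * sqrt (alpha0 d * t)), lam.
  split; [| split; [exact Hlam | split; [exact HVlam | split; [reflexivity | split]]]].
  - apply (similarity_solution d b nb); trivial.
    + lra.
    + apply (is_extended_profile_extended_profile d b nb lam2 HE). lra.
    + rewrite <- Vcal_extended_profile by lra. exact HVlam.
  - apply (is_unique_profile_profile d b nb lam2 HE). lra.
  - intros x t _ Hxi. unfold extended_profile. now rewrite clamp_id.
Qed.
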